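(* Let $(M,g)$ be a Riemannian manifold, $p\in M$, $k\ge 0$, and let $(\mathrm{R}|_p,\nabla|_p\mathrm{R},\ldots,\nabla^k|_p\mathrm{R})$ be the (arbitrary) $k$-jet of its curvature tensor at $p$. Then for all $X_1,\ldots,X_{k+4}\in T_pM$ the expression $$\Big(\frac{1}{k!}\,S^\star_{[1,3,5,\ldots,k+4\,|\,2,4]}\,\nabla^k_{X_5,\ldots,X_{k+4}}-2(k+2)(k+3)\,\mathrm{jet}^k_{X_5,\ldots,X_{k+4}}\Big)\mathrm{R}_{X_1,X_2,X_3,X_4}$$ is equal to $$\begin{aligned} &\sum_{A=1}^k S^\star_{[1,3,A+4\,|\,2,4]}\big(\mathrm{jet}^k_{X_5,\ldots,X_{k+4}}-\mathrm{jet}^{k-1}_{X_5,\ldots,\hat X_{A+4},\ldots,X_{k+4}}\nabla_{X_{A+4}}\big)\mathrm{R}_{X_1,X_2,X_3,X_4}\\ &+\sum_{1\le A<B\le k} S^\star_{[1,3\,|\,2,4]}\big(\mathrm{jet}^k_{X_1,X_3,X_5,\ldots,\hat X_{A+4},\ldots,\hat X_{B+4},\ldots,X_{k+4}}-\mathrm{jet}^{k-2}_{X_5,\ldots,\hat X_{A+4},\ldots,\hat X_{B+4},\ldots,X_{k+4}}\nabla^2_{X_1,X_3}\big)\mathrm{R}_{X_{A+4},X_2,X_{B+4},X_4}\\ &+\sum_{\substack{1\le A,B\le k\\ A\ne B}}\Big(2\,\mathrm{A}_{12}\,\mathrm{jet}^{k-2}_{X_5,\ldots,\hat X_{A+4},\ldots,\hat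 X_{B+4},\ldots,X_{k+4}}\,\mathrm{R}_{X_1,X_{A+4}}\mathrm{R}_{X_{B+4},X_2,X_3,X_4}\\ &\hspace{5em}-\mathrm{A}_{12}\mathrm{A}_{34}\,\mathrm{jet}^{k-2}_{X_5,\ldots,\hat X_{A+4},\ldots,\hat X_{B+4},\ldots,X_{k+4}}\,\mathrm{R}_{X_1,X_3}\mathrm{R}_{X_{A+4},X_2,X_{B+4},X_4}\Big). \end{aligned}$$
   Context: ''Riemannian manifold'' means a smooth manifold $M$ with a nondegenerate symmetric $(0,2)$-tensor field $g=\langle\cdot,\cdot\rangle$ (any signature). $\nabla$ is the Levi-Civita connection, $\mathrm{R}(X,Y)Z=\nabla_X\nabla_YZ-\nabla_Y\nabla_XZ-\nabla_{[X,Y]}Z$, and $\mathrm{R}_{X_1,X_2,X_3,X_4}=\langle \mathrm{R}(X_1,X_2)X_3,X_4\rangle$. Iterated covariant derivatives of a section $\psi$ of a vector bundle with connection are defined by $\nabla^0\psi=\psi$ and $\nabla^{k+1}_{Y,X_1,\ldots,X_k}\psi=\nabla_Y\nabla^k_{X_1,\ldots,X_k}\psi-\sum_{i}\nabla^k_{X_1,\ldots,\nabla_YX_i,\ldots,X_k}\psi$. The symmetrized iterated covariant derivative is $\mathrm{jet}^k_{X_1,\ldots,X_k}\psi=\frac1{k!}\sum_{\sigma\in \mathrm{S}_k}\nabla^k_{X_{\sigma(1)},\ldots,X_{\sigma(k)}}\psi$. A hat means that the argument is omitted. Index $X_i$ in $\nabla^k_{X_5,\ldots,X_{k+4}}\mathrm{R}_{X_1,X_2,X_3,X_4}$: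 $\nabla^k\mathrm{R}$ is regarded as a $(0,k+4)$-tensor. Differential operators act on sections of induced bundles, without the Leibniz rule being applied: $\mathrm{jet}^{k-\ell}_{Z_1,\ldots,Z_{k-\ell}}\nabla^{\ell}_{W_1,\ldots,W_\ell}\mathrm{R}_{Y_1,\ldots,Y_4}$ denotes $\mathrm{jet}^{k-\ell}_{Z_1,\ldots,Z_{k-\ell}}$ applied to the tensor field $\nabla^\ell\mathrm{R}$, evaluated on $(W_1,\ldots,W_\ell,Y_1,\ldots,Y_4)$. Similarly, $\mathrm{jet}^{k-2}_{Z_1,\ldots,Z_{k-2}}\mathrm{R}_{U,V}\mathrm{R}_{Y_1,\ldots,Y_4}$ denotes $\mathrm{jet}^{k-2}_{Z_1,\ldots,Z_{k-2}}$ applied to the $(0,6)$-tensor field $(U,V,Y_1,\ldots,Y_4)\mapsto(\mathrm{R}_{U,V}\mathrm{R})_{Y_1,\ldots,Y_4}$, evaluated on $(U,V,Y_1,\ldots,Y_4)$, where $\mathrm{R}_{U,V}$ acts as a derivation on tensors: $(\mathrm{R}_{U,V}\mathrm{R})_{Y_1,\ldots,Y_4}=-\sum_{\nu=1}^4\mathrm{R}_{Y_1,\ldots,\mathrm{R}(U,V)Y_\nu,\ldots,Y_4}$ (so $\nabla^2_{U,V}\mathrm{R}-\nabla^2_{V,U}\mathrm{R}=\mathrm{R}_{U,V}\mathrm{R}$). Symmetrizers act on expressions that are multilinear functions $f$ of the vectors $X_1,X_2,\ldots$ by permuting these vectors, $(\sigma f)(X_1,X_2,\ldots)=f(X_{\sigma(1)},X_{\sigma(2)},\ldots)$.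 For a two-row Young tableau with first row $a_1,a_2,\ldots,a_m$ and second row $b_1,b_2$, here with $a_1=1,a_2=3,b_1=2,b_2=4$, the Young symmetrizer is $S^\star_{[a_1,\ldots,a_m\,|\,b_1,b_2]}=c\circ r$, where $r=\sum\sigma$ is the sum over all permutations preserving the rows (all permutations of $\{a_1,\ldots,a_m\}$ times all permutations of $\{b_1,b_2\}$), and $c=\sum\mathrm{sgn}(\sigma)\sigma$ is the signed sum over all permutations preserving the columns, i.e. over the group generated by the transpositions $(1\,2)$ and $(3\,4)$. No normalizing factors are included; all vectors not occurring in the tableau are kept fixed. $\mathrm{A}_{12}f$ denotes $f$ minus $f$ with $X_1,X_2$ interchanged; $\mathrm{A}_{34}$ is defined in the same way for $X_3,X_4$. Empty sums are zero. *)

(* Defs.v *)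
From HB Require Import structures.
From mathcomp Require Import all_boot all_order all_algebra fingroup perm.
From mathcomp Require Import boolp classical_sets functions cardinality.
From mathcomp Require Import reals topology normedtype derive.
From mathcomp Require Import ring.

Set Implicit Arguments.
Unset Strict Implicit.
Unset Printing Implicit Defensive.
Import Order.TTheory GRing.Theory Num.Theory.
Import numFieldNormedType.Exports.
Local Open Scope classical_set_scope.
Local Open Scope ring_scope.

Section Ck.
Context {R : realType} {V W : normedModType R}.

(* In finite dimension, C^k on an open set [U] is: the directional derivatives
   of order at most [k] exist and are continuous at every point of [U].  Values
   of [f] outside [U] are irrelevant when [U] is open. *)
Fixpoint Ck (k : nat) (U : set V) (f : V -> W) : Prop :=
  (forall x, U x -> {for x, continuous f}) /\
  match k with
  | 0 => True
  | k'.+1 => forall v : V,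
      (forall x, U x -> derivable f x v) /\ Ck k' U (fun x => 'D_v f x)
  end.

Definition smooth_on (U : set V) (f : V -> W) : Prop := forall k, Ck k U f.

Lemma CkS k U f : Ck k.+1 U f -> Ck k U f.
Proof.
elim: k f => [|k IH] f; first by case.
by case=> cf df; split=> // v; have [dv /IH] := df v.
Qed.

Lemma Ck_eq k U f g : open U -> (forall x, U x -> f x = g x) ->
  Ck k U f -> Ck k U g.
Proof.
move=> oU; elim: k f g => [|k IH] f g fg [cf df].
  split=> // x Ux; have nU : nbhs x U by exact: open_nbhs_nbhs.
  have fgx : \near x, f x = g x by apply: filterS nU.
  rewrite /prop_for /continuous_at -fg //.
  by apply: cvg_trans (cf _ Ux); exact: near_eq_cvg.
have nfg x : U x -> \near x, f x = g x.
  by move=> Ux; apply: filterS (open_nbhs_nbhs (conj oU Ux)).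
split=> [x Ux|v].
  rewrite /prop_for /continuous_at -fg //.
  by apply: cvg_trans (cf _ Ux); apply: near_eq_cvg; exact: nfg.
have [dv Dv] := df v; split=> [x Ux|].
  by apply: near_eq_derivable (dv x Ux); exact: nfg.
apply: IH Dv => x Ux; apply: near_eq_derive; exact: nfg.
Qed.

Lemma Ck_cst k U (c : W) : Ck k U (fun=> c).
Proof.
elim: k c => [|k IH] c; first by split=> // x _; exact: cvg_cst.
split=> [x _|v]; first exact: cvg_cst.
split=> [x _|]; first exact: derivable_cst.
have -> : (fun x : V => 'D_v (fun=> c : W) x) = fun=> 0.
  by apply/funext => x; exact: derive_cst.
exact: IH.
Qed.

Lemma Ck_add k U f g : open U -> Ck k U f -> Ck k U g -> Ck k U (f \+ g).
Proof.
move=> oU; elim: k f g => [|k IH] f g [cf df] [cg dg].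
  by split=> // x Ux; apply: cvgD; [exact: cf|exact: cg].
split=> [x Ux|v]; first by apply: cvgD; [exact: cf|exact: cg].
have [dfv Dfv] := df v; have [dgv Dgv] := dg v.
split=> [x Ux|]; first by apply: derivableD; [exact: dfv|exact: dgv].
apply: Ck_eq (IH _ _ Dfv Dgv) => // x Ux.
by rewrite /= deriveD //; [exact: dfv|exact: dgv].
Qed.

Lemma Ck_scale k U (a : R) f : open U -> Ck k U f -> Ck k U (fun x => a *: f x).
Proof.
move=> oU; elim: k f => [|k IH] f [cf df].
  by split=> // x Ux; apply: cvgZ; [exact: cvg_cst|exact: cf].
split=> [x Ux|v]; first by apply: cvgZ; [exact: cvg_cst|exact: cf].
have [dfv Dfv] := df v.
split=> [x Ux|]; first by apply: derivableZ; exact: dfv.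
apply: Ck_eq (IH _ Dfv) => // x Ux.
by rewrite /= deriveZ //; exact: dfv.
Qed.

End Ck.

Lemma Ck_mul (R : realType) (V : normedModType R) k (U : set V) (f g : V -> R) :
  open U -> Ck k U f -> Ck k U g -> Ck k U (f \* g).
Proof.
move=> oU; elim: k f g => [|k IH] f g.
  by case=> cf _ [cg _]; split=> // x Ux; apply: cvgM; [exact: cf|exact: cg].
move=> Cf Cg; have Cf' := CkS Cf; have Cg' := CkS Cg.
case: Cf Cg => cf df [cg dg].
split=> [x Ux|v]; first by apply: cvgM; [exact: cf|exact: cg].
have [dfv Dfv] := df v; have [dgv Dgv] := dg v.
split=> [x Ux|]; first by apply: derivableM; [exact: dfv|exact: dgv].
apply: Ck_eq (Ck_add oU (IH _ _ Cf' Dgv) (IH _ _ Cg' Dfv)) => // x Ux.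
by rewrite /= deriveM //; [exact: dfv|exact: dgv].
Qed.

Section Manifold.
Context {R : realType} {n : nat}.

Record chart (M : topologicalType) := Chart {
  cdom : set M;
  cmap : M -> 'rV[R]_n;
  cinv : 'rV[R]_n -> M;
  cdom_open : open cdom;
  cimg_open : open (cmap @` cdom);
  cmapK : forall x, cdom x -> cinv (cmap x) = x;
  cmap_cts : forall x, cdom x -> {for x, continuous cmap};
  cinv_cts : forall y, (cmap @` cdom) y -> {for y, continuous cinv} }.

End Manifold.
Arguments chart : clear implicits.

(* The atlas need not be maximal. *)
Record manifold (R : realType) (n : nat) := Manifold {
  mcarrier :> topologicalType;
  atlas : set (chart R n mcarrier);
  mhausdorff : hausdorff_space mcarrier;
  msecond_countable : @second_countable mcarrier;
  atlas_cover : forall x : mcarrier, exists2 c, atlas c & cdom c x;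
  atlas_compat : forall c d, atlas c -> atlas d ->
    smooth_on (cmap c @` (cdom c `&` cdom d)) (cmap d \o cinv c) }.

Section SmoothFunctions.
Context {R : realType} {n : nat} (M : manifold R n).

Definition is_smooth (f : M -> R) : Prop :=
  forall c, atlas c -> smooth_on (cmap c @` cdom c) (f \o cinv c).

Definition smooth_pred : {pred M -> R} := fun f => `[< is_smooth f >].

Lemma smooth_submod : submod_closed smooth_pred.
Proof.
split=> [|a f g /asboolP sf /asboolP sg].
  by apply/asboolP => c _ k; exact: Ck_cst.
apply/asboolP => c Ac k; have oc := @cimg_open _ _ _ c.
exact: (Ck_add oc (Ck_scale a oc (sf _ Ac k)) (sg _ Ac k)).
Qed.

Lemma smooth_subring : subring_closed smooth_pred.
Proof.
split=> [|f g /asboolP sf /asboolP sg|f g /asboolP sf /asboolP sg].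
- by apply/asboolP => c _ k; exact: Ck_cst.
- apply/asboolP => c Ac k; have oc := @cimg_open _ _ _ c.
  have := Ck_add oc (sf _ Ac k) (Ck_scale (-1) oc (sg _ Ac k)).
  by apply: Ck_eq => // x _ /=; rewrite scaleN1r.
- apply/asboolP => c Ac k; exact: (Ck_mul (@cimg_open _ _ _ c) (sf _ Ac k) (sg _ Ac k)).
Qed.

HB.instance Definition _ := GRing.isSubringClosed.Build (M -> R) smooth_pred
  smooth_subring.

HB.instance Definition _ := GRing.isSubmodClosed.Build R (M -> R) smooth_pred
  smooth_submod.

(* The algebra C^oo(M). *)
Record smoothfun := SmoothFun {
  smoothfun_val :> M -> R;
  smoothfunP : smoothfun_val \in smooth_pred }.

HB.instance Definition _ := [isSub for smoothfun_val].
HB.instance Definition _ := [Choice of smoothfun by <:].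
HB.instance Definition _ := GRing.SubChoice_isSubComPzRing.Build (M -> R)
  smooth_pred smoothfun smooth_subring.
HB.instance Definition _ := [SubZmodule_isSubLmodule of smoothfun by <:].

End SmoothFunctions.

Section VectorFields.
Context {R : realType} {n : nat} (M : manifold R n).
Local Notation C := (smoothfun M).

(* T_pM: the derivations at [p] of C^oo(M). *)
Definition derivation_at (p : M) (v : C -> R) : Prop :=
  (forall (a : R) f g, v (a *: f + g) = a * v f + v g) /\
  (forall f g, v (f * g) = f p * v g + v f * g p).

Definition derivation_pred (p : M) : {pred C -> R} :=
  fun v => `[< derivation_at p v >].

Lemma derivation_submod (p : M) : submod_closed (derivation_pred p).
Proof.
split=> [|a u v /asboolP[uL uD] /asboolP[vL vD]]; apply/asboolP; split.
- by move=> a f g; rewrite mulr0 addr0.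
- by move=> f g; rewrite mulr0 mul0r addr0.
- move=> b f g; rewrite -![(a *: u + v) _]/(a * u _ + v _) uL vL.
  by rewrite !mulrDr addrACA mulrCA.
- move=> f g; rewrite -![(a *: u + v) _]/(a * u _ + v _) uD vD.
  by rewrite !mulrDr !mulrDl addrACA !mulrA [a * f p]mulrC.
Qed.

HB.instance Definition _ (p : M) := GRing.isSubmodClosed.Build R (C -> R)
  (derivation_pred p) (derivation_submod p).

Record tangent (p : M) := Tangent {
  tangent_val :> C -> R;
  tangentP : tangent_val \in derivation_pred p }.

HB.instance Definition _ p := [isSub for @tangent_val p].
HB.instance Definition _ p := [Choice of tangent p by <:].
HB.instance Definition _ p := [SubChoice_isSubZmodule of tangent p by <:].
HB.instance Definition _ p := [SubZmodule_isSubLmodule of tangent p by <:].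

(* Smooth sections of the tangent bundle. *)
Record vfield := VField {
  vfield_val :> forall p : M, tangent p;
  vfieldP : forall f : C, (fun p => vfield_val p f) \in @smooth_pred R n M }.

Lemma vfieldE (X Y : vfield) : (forall p f, X p f = Y p f) -> X = Y.
Proof.
case: X Y => [X Xs] [Y Ys] /= XY.
have eXY : X = Y.
  by apply: functional_extensionality_dep => p; apply/val_inj/funext => f /=.
by rewrite {X Xs XY}eXY in Xs *; congr VField; exact: Prop_irrelevance.
Qed.

Definition act (X : vfield) (f : C) : C := SmoothFun (vfieldP X f).

HB.instance Definition _ := gen_eqMixin vfield.
HB.instance Definition _ := gen_choiceMixin vfield.

Fact vfield0_smooth (f : C) :
  (fun p => (0 : tangent p) f) \in @smooth_pred R n M.
Proof. exact: (rpred0 (smooth_pred (M := M))). Qed.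

Fact vfield_opp_smooth (X : vfield) (f : C) :
  (fun p => (- X p) f) \in @smooth_pred R n M.
Proof. by rewrite -[X in X \in _]/(- (act X f : M -> R)) rpredN smoothfunP. Qed.

Fact vfield_add_smooth (X Y : vfield) (f : C) :
  (fun p => (X p + Y p) f) \in @smooth_pred R n M.
Proof.
by apply: (@rpredD _ (smooth_pred (M := M)) (act X f) (act Y f)); exact: smoothfunP.
Qed.

Fact vfield_scale_smooth (h : C) (X : vfield) (f : C) :
  (fun p => (h p *: X p) f) \in @smooth_pred R n M.
Proof.
by apply: (@rpredM _ (smooth_pred (M := M)) h (act X f)); exact: smoothfunP.
Qed.

Definition vfield0 : vfield := VField vfield0_smooth.
Definition vfield_opp X : vfield := VField (vfield_opp_smooth X).
Definition vfield_add X Y : vfield := VField (vfield_add_smooth X Y).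
Definition vfield_scale h X : vfield := VField (vfield_scale_smooth h X).

Fact vfield_addA : associative vfield_add.
Proof. by move=> X Y Z; apply: vfieldE => p f /=; rewrite addrA. Qed.
Fact vfield_addC : commutative vfield_add.
Proof. by move=> X Y; apply: vfieldE => p f /=; rewrite addrC. Qed.
Fact vfield_add0 : left_id vfield0 vfield_add.
Proof. by move=> X; apply: vfieldE => p f /=; rewrite add0r. Qed.
Fact vfield_addN : left_inverse vfield0 vfield_opp vfield_add.
Proof. by move=> X; apply: vfieldE => p f /=; rewrite addNr. Qed.

HB.instance Definition _ := GRing.isZmodule.Build vfield
  vfield_addA vfield_addC vfield_add0 vfield_addN.

Fact vfield_scaleA (a b : C) X :
  vfield_scale a (vfield_scale b X) = vfield_scale (a * b) X.
Proof. by apply: vfieldE => p f /=; rewrite scalerA. Qed.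
Fact vfield_scale1 : left_id 1 vfield_scale.
Proof. by move=> X; apply: vfieldE => p f /=; rewrite scale1r. Qed.
Fact vfield_scaleDr : right_distributive vfield_scale +%R.
Proof. by move=> a X Y; apply: vfieldE => p f /=; rewrite scalerDr. Qed.
Fact vfield_scaleDl X : {morph vfield_scale^~ X : a b / a + b}.
Proof. by move=> a b; apply: vfieldE => p f /=; rewrite scalerDl. Qed.

(* The C^oo(M)-module of vector fields. *)
HB.instance Definition _ := GRing.Zmodule_isLmodule.Build C vfield
  vfield_scaleA vfield_scale1 vfield_scaleDr vfield_scaleDl.

Lemma act_linear (X : vfield) (a : R) (f g : C) :
  act X (a *: f + g) = a *: act X f + act X g.
Proof.
by apply/val_inj/funext => p; have /asboolP[XL _] := tangentP (X p); exact: XL.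
Qed.

Lemma act_leibniz (X : vfield) (f g : C) :
  act X (f * g) = f * act X g + act X f * g.
Proof.
by apply/val_inj/funext => p; have /asboolP[_ XD] := tangentP (X p); exact: XD.
Qed.

Fact bracket_derivation (X Y : vfield) (p : M) :
  (fun f : C => X p (act Y f) - Y p (act X f)) \in derivation_pred p.
Proof.
have /asboolP[XL XD] := tangentP (X p); have /asboolP[YL YD] := tangentP (Y p).
apply/asboolP; split=> [a f g|f g].
  by rewrite !act_linear XL YL mulrBr opprD addrACA.
rewrite !act_leibniz -[f * act Y g]scale1r -[f * act X g]scale1r XL YL !mul1r.
rewrite !XD !YD /=; ring.
Qed.

Fact bracket_smooth (X Y : vfield) (f : C) :
  (fun p => Tangent (bracket_derivation X Y p) f) \in @smooth_pred R n M.
Proof.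
apply: (@rpredB _ (smooth_pred (M := M)) (act X (act Y f)) (act Y (act X f)));
  exact: smoothfunP.
Qed.

Definition bracket (X Y : vfield) : vfield := VField (bracket_smooth X Y).

End VectorFields.

Arguments act {R n M} X f.

Section Geometry.
Context {R : realType} {n : nat} (M : manifold R n).
Local Notation C := (smoothfun M).

(* A nondegenerate symmetric (0,2)-tensor field, of arbitrary signature. *)
Record metric := Metric {
  metric_at :> forall p : M, tangent p -> tangent p -> R;
  metric_sym : forall p u v, @metric_at p u v = @metric_at p v u;
  metric_lin : forall p (a : R) u v w,
    @metric_at p (a *: u + v) w = a * @metric_at p u w + @metric_at p v w;
  metric_nondeg : forall p u, (forall v, @metric_at p u v = 0) -> u = 0;
  metricP : forall X Y : vfield M,
    (fun p => @metric_at p (X p) (Y p)) \in @smooth_pred R n M }.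

Definition inner (g : metric) (X Y : vfield M) : C := SmoothFun (metricP g X Y).

Record levi_civita (g : metric) (nabla : vfield M -> vfield M -> vfield M) : Prop :=
  LeviCivita {
  nabla_linl : forall (f : C) X Y Z,
    nabla (f *: X + Y) Z = f *: nabla X Z + nabla Y Z;
  nabla_addr : forall X Y Z, nabla X (Y + Z) = nabla X Y + nabla X Z;
  nabla_leibniz : forall X (f : C) Y,
    nabla X (f *: Y) = act X f *: Y + f *: nabla X Y;
  nabla_torsion_free : forall X Y, nabla X Y - nabla Y X = bracket X Y;
  nabla_metric : forall X Y Z,
    act X (inner g Y Z) = inner g (nabla X Y) Z + inner g Y (nabla X Z) }.

(* A (0,m)-tensor field, given by its values on vector fields.  C^oo(M)-
   multilinearity is not part of the type; the curvature tensor has it and the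
   operations below preserve it.  The value of T at p on tangent vectors
   x_1,..,x_m is T(X_1,..,X_m)(p) for any vector fields X_i with X_i(p) = x_i. *)
Definition tensor (m : nat) := m.-tuple (vfield M) -> C.

Definition subst_arg m (Y : m.-tuple (vfield M)) (i : 'I_m) (Z : vfield M) :=
  [tuple if j == i then Z else tnth Y j | j < m].

Section Connection.
Variable D : vfield M -> vfield M -> vfield M.

Definition curv (X Y Z : vfield M) : vfield M :=
  D X (D Y Z) - D Y (D X Z) - D (bracket X Y) Z.

Definition riemann (g : metric) : tensor 4 := fun Y =>
  inner g (curv (tnth Y 0) (tnth Y 1) (tnth Y 2)) (tnth Y 3).

(* [cov Y T] is nabla_Y T for the connection induced on (0,m)-tensors. *)
Definition cov m (Y : vfield M) (T : tensor m) : tensor m := fun Z =>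
  act Y (T Z) - \sum_(i < m) T (subst_arg Z i (D Y (tnth Z i))).

Fixpoint nablak m (T : tensor m) (k : nat) : k.-tuple (vfield M) -> tensor m :=
  match k with
  | 0 => fun _ => T
  | k'.+1 => fun YX => let Y := thead YX in let X := [tuple of behead YX] in
      fun Z => cov Y (nablak T X) Z
               - \sum_(i < k') nablak T (subst_arg X i (D Y (tnth X i))) Z
  end.

(* nabla^k_{X_1,..,X_k} T and jet^k_{X_1,..,X_k} T, with k the length of the
   list X of derivative directions. *)
Definition nabla m (X : seq (vfield M)) (T : tensor m) : tensor m :=
  nablak T (in_tuple X).

Definition jet m (X : seq (vfield M)) (T : tensor m) : tensor m := fun Z =>
  ((size X)`!%:R^-1 : R) *:
  \sum_(s : 'S_(size X)) nablak T [tuple tnth (in_tuple X) (s i) | i < size X] Z.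

(* nabla^l T as a (0,l+m)-tensor field. *)
Definition nablaT m (T : tensor m) (l : nat) :
  tensor (l + m) := fun W =>
  nablak T [tuple tnth W (lshift m i) | i < l] [tuple tnth W (rshift l i) | i < m].

(* The (0,2+m)-tensor field (U,V,Y_1,..,Y_m) |-> (R_{U,V} T)(Y_1,..,Y_m). *)
Definition curv_act m (T : tensor m) : tensor (2 + m) := fun W =>
  let U := tnth W (lshift m 0) in let V := tnth W (lshift m 1) in
  let Y := [tuple tnth W (rshift 2 i) | i < m] in
  - \sum_(i < m) T (subst_arg Y i (curv U V (tnth Y i))).

End Connection.
End Geometry.

Arguments nablaT {R n M} D {m} T l.

Section Symmetrizers.
Local Close Scope classical_set_scope.
Local Open Scope set_scope.
Context {T : Type} {C : pzRingType} {N : nat}.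
Local Notation fn := (N.+1.-tuple T -> C).

(* The vectors X_1,..,X_{N+1} are numbered from 1. *)
Definition pos (i : nat) : 'I_N.+1 := inord i.-1.

Definition arg (X : N.+1.-tuple T) (i : nat) : T := tnth X (pos i).

Definition pact (s : 'S_N.+1) (f : fn) : fn := fun X =>
  f [tuple tnth X (s i) | i < N.+1].

Definition row_group (a b : seq 'I_N.+1) : {set 'S_N.+1} :=
  (Sym [set i in a] * Sym [set i in b])%g.

(* [zip a b] lists the columns of length 2 of the tableau with rows a and b,
   b being at most as long as a. *)
Definition col_group (a b : seq 'I_N.+1) : {set 'S_N.+1} :=
  <<[set tperm c.1 c.2 | c in zip a b]>>%g.

Definition row_sym a b (f : fn) : fn := fun X =>
  \sum_(s in row_group a b) pact s f X.

Definition col_sym a b (f : fn) : fn := fun X =>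
  \sum_(s in col_group a b) (-1) ^+ s * pact s f X.

(* The tableau with rows a and b, its entries being the numbers of the vectors. *)
Definition young (a b : seq nat) (f : fn) : fn :=
  col_sym (map pos a) (map pos b) (row_sym (map pos a) (map pos b) f).

Definition alt (i j : nat) (f : fn) : fn := fun X =>
  f X - pact (tperm (pos i) (pos j)) f X.

End Symmetrizers.

Notation "X $ i" := (arg X i) (at level 2, i at level 1, format "X $ i").

(* X_5,..,X_{k+4} with the X_i, i \in omit, left out. *)
Definition hat (T : Type) (k : nat) (X : k.+4.-tuple T) (omit : seq nat) : seq T :=
  [seq X$i | i <- iota 5 k & i \notin omit].

(* Main.v *)
(** The left-hand side and the right-hand side are linear combinations of the
    values F(w_1..w_k; a,b,c,d) of nabla^k R at p, so it suffices to use the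
    linear relations of F: the algebraic curvature symmetries in a,b,c,d, the
    second Bianchi identity in (w_k,a,b), and the Ricci identity, which turns
    R_{U,V} R into a difference of two second derivatives.

    The row sums over [1,3,5..k+4] are sums over the pair (u,v) of vectors put
    into the slots 1 and 3; up to k!, the derivatives are averaged into a jet.
    The pairs (u,v) taken from {1,3,A} reproduce, for each A, the row sum of
    the tableau [1,3,A | 2,4] applied to jet^k R, except that the two pairs
    from {1,3} are counted k times on the right; the pairs (A,B) reproduce the
    terms jet^k_{X_1,X_3,..}.  What remains has an innermost derivative not
    symmetrized with the others: by the Bianchi identities, column by column,
    the terms with innermost nabla_{X_A} collapse to 24 times R_{1234} with
    innermost nabla_{X_A}, and those with nabla^2, together with the Ricci
    terms, to multiples of nabla^2_{X_A,X_B} R_{1234}.  Summing over A and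
    (A,B) gives back jet^k R_{1234}, and the coefficients agree. *)

Require Import Defs.
From mathcomp Require Import all_boot all_order all_algebra.
From mathcomp Require Import fingroup perm cyclic boolp reals topology.
From mathcomp Require Import zify ring lra.

Set Implicit Arguments.
Unset Strict Implicit.
Unset Printing Implicit Defensive.
Import GRing.Theory Num.Theory.
Local Open Scope ring_scope.

(** * Averages over arrangements *)

Section SymmetricGroup.
Context {T : finType}.
Implicit Types (S : {set T}) (s h : {perm T}) (a : T) (l : seq T).

Lemma Sym_out S s x : s \in Sym S -> x \notin S -> s x = x.
Proof. by rewrite inE => sS xS; exact: out_perm sS xS. Qed.

Lemma sum_Sym_le1 (V : nmodType) S (f : {perm T} -> V) : (#|S| <= 1)%N ->
  \sum_(s in Sym S) f s = f 1%g.
Proof.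
move=> /card_le1_eqP S1; rewrite (big_pred1 1%g) // => s /=.
rewrite inE; apply/idP/eqP => [sS|->]; last exact: perm_on1.
apply/permP => x; rewrite perm1; have [xS|xS] := boolP (x \in S).
  by apply: S1 => //; rewrite perm_closed.
exact: out_perm sS xS.
Qed.

(* The transpositions [tperm a u] are a transversal of the stabilizer of [a]. *)
Lemma sum_SymU1 (V : nmodType) a S (f : {perm T} -> V) : a \notin S ->
  \sum_(s in Sym (a |: S)) f s =
  \sum_(u in a |: S) \sum_(h in Sym S) f (h * tperm a u)%g.
Proof.
move=> aS; rewrite (partition_big (fun s : {perm T} => s a) [in a |: S]) /=; last first.
  by move=> s; rewrite inE => sS; rewrite (perm_closed a sS) setU11.
apply: eq_bigr => u uS; rewrite (reindex_inj (mulIg (tperm a u))) /=.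
apply: eq_bigl => h; rewrite !inE permM.
have tS : perm_on (a |: S) (tperm a u).
  apply/subsetP => x; rewrite inE /=.
  by case: tpermP => [->|->|_ _]; rewrite ?eqxx ?setU11.
apply/andP/idP => [[hS /eqP]|hS].
  rewrite -{2}(tpermL a u) => /perm_inj ha.
  have {}hS : perm_on (a |: S) h.
    by rewrite -(mulgK (tperm a u) h) tpermV; exact: perm_onM.
  apply/subsetP => x; rewrite inE => hx.
  have : x \in a |: S by apply: (subsetP hS); rewrite inE.
  by rewrite !inE; case/orP => // /eqP xa; rewrite xa ha eqxx in hx.
split; last by rewrite (out_perm hS aS) tpermL.
apply: perm_onM => //; apply: subset_trans hS _; exact: subsetUr.
Qed.

End SymmetricGroup.

Section SymmetricAverage.
Context {R : numFieldType} {T : eqType}.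
Implicit Types (l : seq T) (G H : seq T -> R).

(** [permutations] lists distinct arrangements only, so this is a mean for duplicate-free [l], the
    case that corresponds to jets. *)
Definition av l G : R :=
  (size l)`!%:R^-1 * \sum_(r <- permutations l) G r.

Lemma eq_av l G H : G =1 H -> av l G = av l H.
Proof. by move=> GH; congr (_ * _); apply: eq_bigr. Qed.

Lemma avD l G H : av l (fun r => G r + H r) = av l G + av l H.
Proof. by rewrite /av big_split mulrDr. Qed.

Lemma avN l G : av l (fun r => - G r) = - av l G.
Proof. by rewrite /av sumrN mulrN. Qed.

Lemma av0 l : av l (fun=> 0) = 0.
Proof. by rewrite /av big1 ?mulr0. Qed.

Lemma av_perm l l' G : perm_eq l l' -> av l G = av l' G.
Proof.
move=> ll'; rewrite /av (perm_size ll'); congr (_ * _).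
exact/perm_big/perm_permutations.
Qed.

(* Sort the arrangements of [l] by their last entry, i.e. by the innermost
   derivative. *)
Lemma av_rcons l G : uniq l ->
  (size l)%:R * av l G =
  \sum_(a <- l) av [seq x <- l | x != a] (fun r => G (rcons r a)).
Proof.
case: l => [|b l0] ul; first by rewrite /av !big_nil mul0r.
set l := b :: l0 in ul *.
have sz a : a \in l -> size [seq x <- l | x != a] = size l0.
  by move=> al; rewrite -rem_filter // size_rem.
transitivity ((size l0)`!%:R^-1 * \sum_(a <- l)
    \sum_(r <- permutations [seq x <- l | x != a]) G (rcons r a)); last first.
  by rewrite big_distrr; apply: eq_big_seq => a al; rewrite /av sz.
rewrite /av [size l]/= factS natrM invfM mulrA mulrA divff ?pnatr_eq0 // mul1r.
congr (_ * _).
transitivity (\sum_(q <- [seq (a, r) | a <- l,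
     r <- permutations [seq x <- l | x != a]]) G (rcons q.2 q.1)); last first.
  by rewrite big_allpairs_dep.
rewrite -(big_map (fun q => rcons q.2 q.1) xpredT G).
apply/perm_big/uniq_perm; first exact: permutations_uniq.
  rewrite map_inj_in_uniq; last first.
    by move=> [a r] [a' r'] _ _ /= /rcons_inj[-> ->].
  apply: allpairs_uniq_dep => // [a _|]; first exact: permutations_uniq.
  by move=> [a r] [a' r'] _ _ /= [-> ->].
move=> r; rewrite mem_permutations; apply/idP/mapP => [rl|].
  case/lastP: r rl => [|r a] ra; first by have := perm_size ra.
  have al : a \in l by rewrite -(perm_mem ra) mem_rcons mem_head.
  exists (a, r) => //; apply/allpairsPdep; exists a, r; split=> //.
  rewrite mem_permutations -rem_filter // -(perm_cons a).
  by rewrite -(permPr (perm_to_rem al)) -perm_rcons.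
move=> [_ /allpairsPdep[a [r' [al + ->]]] ->] /=.
rewrite mem_permutations -rem_filter //= => rr.
by rewrite perm_rcons (permPr (perm_to_rem al)) perm_cons.
Qed.

End SymmetricAverage.

Section SumOverArrangements.
Context {V : nmodType}.

Lemma perm_permutations_map (T : finType) (s : {perm T}) (l : seq T) :
  perm_eq (permutations (map s l)) (map (map s) (permutations l)).
Proof.
apply: uniq_perm; first exact: permutations_uniq.
  by rewrite map_inj_uniq ?permutations_uniq //; exact/inj_map/perm_inj.
move=> r; rewrite mem_permutations; apply/idP/mapP => [rl|[r' +] ->]; last first.
  by rewrite mem_permutations => /(perm_map s).
exists (map s^-1%g r); last by rewrite mapK //; exact: permKV.
by rewrite mem_permutations -[l](mapK (permK s)) perm_map.
Qed.

(** A permutation supported on the entries of [l] is determined by the image of [l], and there are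
    as many such permutations as arrangements. *)
Lemma sum_Sym_map (T : finType) (l : seq T) (G : seq T -> V) : uniq l ->
  \sum_(h in Sym [set i in l]) G (map h l) = \sum_(r <- permutations l) G r.
Proof.
move=> ul; rewrite -big_enum /=.
rewrite -(big_map (fun h : {perm T} => map h l) xpredT G).
set S := [set i in l]; apply: perm_big.
have Si (h : {perm T}) : h \in Sym S -> map h l \in permutations l.
  rewrite mem_permutations inE => hS; apply: uniq_perm => //.
    by rewrite map_inj_uniq //; exact: perm_inj.
  move=> x; apply/mapP/idP => [[y yl ->]|xl].
    by have := perm_closed y hS; rewrite !inE yl.
  exists (h^-1%g x); last by rewrite permKV.
  by have := perm_closed (h^-1%g x) hS; rewrite !inE permKV xl => <-.
have uE : uniq [seq (map (h : {perm T}) l) | h <- enum (Sym S)].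
  rewrite map_inj_in_uniq ?enum_uniq // => h h'; rewrite !mem_enum => hS h'S.
  move=> /eq_in_map hh; apply/permP => x; have [|xS] := boolP (x \in S).
    by rewrite inE; exact: hh.
  by rewrite !(Sym_out _ xS).
apply: uniq_perm => //; first exact: permutations_uniq.
(* An injection between finite sets of the same size is onto; no permutation has to be built from an
   arrangement. *)
have [] // := uniq_min_size uE (s2 := permutations l).
  by move=> _ /mapP[h + ->]; rewrite mem_enum; exact: Si.
rewrite size_map -cardE card_Sym size_permutations //.
by rewrite cardsE (card_uniqP ul).
Qed.

Lemma sum_perm_tnth (T : eqType) n (t : n.-tuple T) (G : seq T -> V) : uniq t ->
  \sum_(s : 'S_n) G [tuple tnth t (s i) | i < n] =
  \sum_(r <- permutations t) G r.
Proof.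
move=> ut; rewrite -big_enum /=.
rewrite -(big_map (fun s : 'S_n => val [tuple tnth t (s i) | i < n]) xpredT G).
apply: perm_big; apply: uniq_perm; rewrite ?permutations_uniq //.
  rewrite map_inj_uniq ?enum_uniq // => s s' ss'; apply/permP => i.
  have /(congr1 (fun q => tnth q i)) : [tuple tnth t (s i) | i < n] =
    [tuple tnth t (s' i) | i < n] by exact: val_inj.
  rewrite !tnth_mktuple => /(tuple_uniqP _ ut); exact.
move=> r; rewrite mem_permutations; apply/mapP/tuple_permP => [[s _ ->]|[s ->]];
  by exists s; rewrite ?mem_enum.
Qed.

End SumOverArrangements.

(** * Algebraic curvature identities *)

Section ColumnsAndRows.
Context {V : zmodType} {T : Type}.
Variables e1 e2 e3 e4 : T.
Implicit Types f : T -> T -> T -> T -> V.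

Definition col4 f : V :=
  f e1 e2 e3 e4 - f e2 e1 e3 e4 - f e1 e2 e4 e3 + f e2 e1 e4 e3.

Definition swap24 f a b c d : V := f a b c d + f a d c b.

(* The symmetrizer of the tableau with rows [e1 e3 ...] and [e2 e4], for [f]
   already symmetrized along the first row. *)
Definition young4 f : V := col4 (swap24 f).

Lemma eq_young4 f g : (forall a b c d, f a b c d = g a b c d) ->
  young4 f = young4 g.
Proof. by move=> fg; rewrite /young4 /col4 /swap24 !fg. Qed.

Lemma young4_swap f : young4 (fun a b c d => f a d c b) = young4 f.
Proof. by rewrite /young4 /col4 /swap24; congr (_ - _ - _ + _); exact: addrC. Qed.

Lemma young4_sum (I : Type) (r : seq I) (P : pred I) (F : I -> T -> T -> T -> T -> V) :
  young4 (fun a b c d => \sum_(i <- r | P i) F i a b c d) =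
  \sum_(i <- r | P i) young4 (F i).
Proof. by rewrite /young4 /col4 /swap24 !(sumrB, big_split). Qed.

End ColumnsAndRows.

Section CurvatureSymmetries.
Context {R : realFieldType} {T : Type}.
Implicit Types (q : T -> T -> T -> T -> R) (Q : T -> T -> T -> T -> T -> R).

Definition algebraic_curvature q : Prop :=
  [/\ forall a b c d, q b a c d = - q a b c d,
      forall a b c d, q a b d c = - q a b c d &
      forall a b c d, q a b c d + q b c a d + q c a b d = 0].

Definition second_bianchi Q : Prop :=
  forall w a b c d, Q w a b c d + Q a b w c d + Q b w a c d = 0.

(** The octahedron argument: a linear combination of the four first Bianchi identities obtained by
    rotating [a b c d]. *)
Lemma curvature_pair q a b c d : algebraic_curvature q -> q c d a b = q a b c d.
Proof.
case=> q12 q34 qB.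
have := qB a b c d; have := qB b c d a; have := qB c d a b; have := qB d a b c.
rewrite (q12 a c b) (q34 b c a) (q34 c d a) (q12 b d c) (q34 b d a).
rewrite (q12 a d c) (q34 a d b) (q34 a c b) (q12 a d b) (q34 a b c); lra.
Qed.

(* Up to the symmetries, the 24 arrangements of four vectors give three values,
   whose signed sum vanishes; this rule is a normal form in terms of two. *)
Lemma curvature_table q (qc : algebraic_curvature q) a b c d
    (x := q a b c d) (y := q a c b d) :
  (q a b d c = - x) * (q b a c d = - x) * (q b a d c = x) *
  (q c d a b = x) * (q c d b a = - x) * (q d c a b = - x) * (q d c b a = x) *
  ((q a c d b = - y) * (q c a b d = - y) * (q c a d b = y) *
   (q b d a c = y) * (q b d c a = - y) * (q d b a c = - y) * (q d b c a = y)) *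
  ((q a d b c = y - x) * (q a d c b = x - y) * (q d a b c = x - y) *
   (q d a c b = y - x) * (q b c a d = y - x) * (q b c d a = x - y) *
   (q c b a d = x - y) * (q c b d a = y - x)).
Proof.
have [q12 q34 qB] := qc.
have pr a' b' c' d' := curvature_pair a' b' c' d' qc.
have bc : q b c a d = y - x.
  by have := qB a b c d; rewrite (q12 a c b) -/x -/y; lra.
rewrite (q34 a b c) (q34 c d a) (q34 b a c) (q34 d c a) (q12 a b c) (q12 c d).
rewrite (pr a b c d) (q34 a c b) (q34 c a b) (q12 a c) (q34 b d a) (q34 d b a).
rewrite (q12 b d a) (pr a c b d) (q34 b c a) (q34 c b a) (q12 b c).
rewrite (q34 a d b) (q34 d a b) (q12 a d b) -(pr a d b c) bc -/x -/y.
by do !split; lra.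
Qed.

(** With [x = q e1 e2 e3 e4] and [y = q e1 e3 e2 e4], the four column permutations contribute, signs
    included, [4x - 2y], [2x + 2y], [2x + 2y] and [4x - 2y]. *)
Lemma young4_curvature q e1 e2 e3 e4 : algebraic_curvature q ->
  young4 e1 e2 e3 e4 (fun a b c d => q a b c d + q c b a d) =
  12 * q e1 e2 e3 e4.
Proof.
move=> qc; rewrite /young4 /col4 /swap24 !(curvature_table qc e1 e2 e3 e4); ring.
Qed.

(** The first two terms give 12 by [young4_curvature]. In the other four [w] occupies a curvature
    slot, and the second Bianchi identity for [w] with each of the two columns gives another 12. *)
Lemma young4_nabla Q w e1 e2 e3 e4 :
  (forall v, algebraic_curvature (Q v)) -> second_bianchi Q ->
  young4 e1 e2 e3 e4 (fun a b c d => Q w a b c d + Q w c b a d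
    + (Q c a b w d + Q a c b w d + Q a w b c d + Q c w b a d)) =
  24 * Q w e1 e2 e3 e4.
Proof.
move=> Qc QB; have := QB w e1 e2 e3 e4; have := QB w e3 e4 e1 e2.
rewrite /young4 /col4 /swap24 !(curvature_table (Qc w) e1 e2 e3 e4).
rewrite !(curvature_table (Qc e1) w e2 e3 e4).
rewrite !(curvature_table (Qc e2) w e1 e3 e4).
rewrite !(curvature_table (Qc e3) w e4 e1 e2).
rewrite !(curvature_table (Qc e4) w e3 e1 e2); lra.
Qed.

(* [Q u v] stands for [nabla^2_{u,v} R] under the remaining derivatives: this is
   the Ricci term of the statement for [A = v] and [B = w]. *)
Definition alternated_ricci (Q : T -> T -> T -> T -> T -> T -> R)
    e1 e2 e3 e4 v w : R :=
  2 * ((Q e1 v w e2 e3 e4 - Q v e1 w e2 e3 e4) -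
       (Q e2 v w e1 e3 e4 - Q v e2 w e1 e3 e4)) -
  col4 e1 e2 e3 e4 (fun a b c d => Q a c v b w d - Q c a v b w d).

(** The Ricci term need not be symmetric in [v] and [w]; only the sum over both orders
    simplifies. *)
Lemma young4_nabla2 (Q : T -> T -> T -> T -> T -> T -> R) v w e1 e2 e3 e4 :
  (forall v w, algebraic_curvature (Q v w)) -> (forall v, second_bianchi (Q v)) ->
  young4 e1 e2 e3 e4 (fun a b c d => Q a c v b w d + Q c a v b w d) -
  (alternated_ricci Q e1 e2 e3 e4 v w + alternated_ricci Q e1 e2 e3 e4 w v) =
  2 * (Q v w e1 e2 e3 e4 + Q w v e1 e2 e3 e4).
Proof.
move=> Qc QB.
(* The first argument is the outer derivative, which stays fixed; the next three form the Bianchi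
   triple. *)
have := QB e1 e3 w e4 v e2; have := QB e1 e3 v e4 w e2.
have := QB e2 e3 w e4 v e1; have := QB e2 e3 v e4 w e1.
have := QB v e1 w e2 e3 e4; have := QB w e1 v e2 e3 e4.
rewrite /young4 /alternated_ricci /col4 /swap24.
rewrite !(curvature_table (Qc e1 e3) v e2 w e4).
rewrite !(curvature_table (Qc e1 e4) v e2 w e3).
rewrite !(curvature_table (Qc e2 e3) v e1 w e4).
rewrite !(curvature_table (Qc e2 e4) v e1 w e3).
rewrite !(curvature_table (Qc e3 e1) v e2 w e4).
rewrite !(curvature_table (Qc e4 e1) v e2 w e3).
rewrite !(curvature_table (Qc e3 e2) v e1 w e4).
rewrite !(curvature_table (Qc e4 e2) v e1 w e3).
rewrite !(curvature_table (Qc e1 v) w e2 e3 e4).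
rewrite !(curvature_table (Qc e1 w) v e2 e3 e4).
rewrite !(curvature_table (Qc e2 v) w e1 e3 e4).
rewrite !(curvature_table (Qc e2 w) v e1 e3 e4).
rewrite !(curvature_table (Qc v e2) w e1 e3 e4).
rewrite !(curvature_table (Qc w e2) v e1 e3 e4).
rewrite !(curvature_table (Qc v w) e1 e2 e3 e4).
rewrite !(curvature_table (Qc w v) e1 e2 e3 e4).
lra.
Qed.

Lemma young4D e1 e2 e3 e4 (f g : T -> T -> T -> T -> R) :
  young4 e1 e2 e3 e4 (fun a b c d => f a b c d + g a b c d) =
  young4 e1 e2 e3 e4 f + young4 e1 e2 e3 e4 g.
Proof. rewrite /young4 /col4 /swap24; ring. Qed.

Lemma young4Z e1 e2 e3 e4 (m : R) (f : T -> T -> T -> T -> R) :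
  young4 e1 e2 e3 e4 (fun a b c d => m * f a b c d) = m * young4 e1 e2 e3 e4 f.
Proof. rewrite /young4 /col4 /swap24; ring. Qed.

Lemma young4B e1 e2 e3 e4 (f g : T -> T -> T -> T -> R) :
  young4 e1 e2 e3 e4 (fun a b c d => f a b c d - g a b c d) =
  young4 e1 e2 e3 e4 f - young4 e1 e2 e3 e4 g.
Proof. rewrite /young4 /col4 /swap24; ring. Qed.

End CurvatureSymmetries.

(** * Young symmetrizers *)

(** Disjoint supports make the factorization unique: on [A] a product acts as its first factor. *)
Lemma sum_mulg_Sym (V : nmodType) (T : finType) (A B : {set T})
    (f : {perm T} -> V) : [disjoint A & B] ->
  \sum_(s in (Sym A * Sym B)%g) f s =
  \sum_(x in Sym A) \sum_(y in Sym B) f (x * y)%g.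
Proof.
move=> dAB; rewrite [(_ * _)%g]curry_imset2X big_imset /=; last first.
  move=> [x y] [x' y'] /setXP[/= xA yB] /setXP[/= xA' yB'] xy.
  have xx' : x = x'.
    apply/permP => i; have [iA|iA] := boolP (i \in A); last first.
      by rewrite !(Sym_out _ iA).
    have out (z w : {perm T}) : z \in Sym A -> w \in Sym B -> (z * w)%g i = z i.
      rewrite inE => zA wB; rewrite permM (Sym_out wB) // (disjointFr dAB) //.
      by rewrite (perm_closed i zA).
    by rewrite -(out x y) // -(out x' y') // xy.
  by move: xy; rewrite xx' => /mulgI ->.
rewrite pair_big_dep /=; apply: eq_big => [[x y]|[x y]] //=.
by rewrite in_setX.
Qed.

(** The two transpositions commute, so they generate the product of two cyclic groups of order 2. *)
Lemma gen_pair_tperm (T : finType) (a b c d : T) : uniq [:: a; b; c; d] ->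
  <<[set tperm a b; tperm c d]>>%g =
  [set 1; tperm a b; tperm c d; tperm a b * tperm c d]%g.
Proof.
rewrite /= !inE !negb_or => /and4P[/and3P[ab ac ad] /andP[bc bd] cd _].
have comm : commute (tperm a b) (tperm c d).
  apply/permP => x; rewrite !permM; case: (tpermP c d x) => [->|->|xc xd].
  - by rewrite [tperm a b c]tpermD // [tperm a b d]tpermD // tpermL.
  - by rewrite [tperm a b c]tpermD // [tperm a b d]tpermD // tpermR.
  by case: (tpermP a b x) => *; rewrite tpermD // eq_sym //; apply/eqP; auto.
have ord2 (x y : T) : x != y -> #[tperm x y]%g = 2%N.
  move=> xy; apply: nt_prime_order => //; first by rewrite expgS expg1 tperm2.
  apply: contra_neq xy => /(congr1 (fun s : {perm T} => s x)).
  by rewrite tpermL perm1.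
have -> : <<[set tperm a b; tperm c d]>>%g = (<[tperm a b]> * <[tperm c d]>)%g.
  rewrite -cent_joinEr; last by rewrite cent_cycle cycle_subG; apply/cent1P.
  by rewrite joing_idl joing_idr.
rewrite !cycle2g ?ord2 // mulUg !mulgU !mulg_set1 !mul1g mulg1.
by apply/setP => x; rewrite !inE -!orbA; case: (x == 1%g) => //; case: (x == tperm a b);
  case: (x == tperm c d); rewrite ?orbT.
Qed.

Section YoungSymmetrizer.
Context {T : Type} {C : pzRingType} {k : nat}.
Local Notation fn := (k.+4.-tuple T -> C).
Local Notation I := 'I_k.+4.
Local Notation e := (@pos k.+3).

(** Products of permutations are read from left to right, so a prior rearrangement by [c] multiplies
    [s] on the right. *)
Lemma pactM (s c : 'S_k.+4) (f : fn) X :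
  pact s f [tuple tnth X (c i) | i < k.+4] = pact (s * c)%g f X.
Proof.
congr (f _); apply: eq_from_tnth => i; by rewrite !tnth_mktuple permM.
Qed.

(** [pos] takes a predecessor, so 0 and 1 have the same position; hence the lower bound. *)
Lemma pos_eq i j : (0 < i <= k.+4)%N -> (0 < j <= k.+4)%N ->
  (e i == e j) = (i == j).
Proof.
move=> /andP[i0 ik] /andP[j0 jk].
by rewrite -(inj_eq val_inj) /= !inordK; case: i j i0 j0 ik jk => [|i] [|j].
Qed.

Lemma col_group4 (l : seq I) :
  col_group (e 1 :: e 3 :: l) [:: e 2; e 4] =
  [set 1; tperm (e 1) (e 2); tperm (e 3) (e 4);
    tperm (e 1) (e 2) * tperm (e 3) (e 4)]%g.
Proof.
rewrite /col_group -gen_pair_tperm; last by rewrite /= !inE !pos_eq.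
have -> : zip (e 1 :: e 3 :: l) [:: e 2; e 4] = [:: (e 1, e 2); (e 3, e 4)].
  by case: l.
congr <<_>>%g; apply/setP => s; rewrite !inE /=.
apply/imsetP/orP => [[c] +->|[]/eqP->].
- by rewrite /= !inE => /orP[]/eqP->; rewrite eqxx; [left|right].
- by exists (e 1, e 2) => //=; rewrite !inE eqxx.
- by exists (e 3, e 4) => //=; rewrite !inE eqxx orbT.
Qed.

(** The transversal of [sum_SymU1] is used for [e 1] and then for [e 3], which leaves [h] to permute
    the rest of the row; the second row contributes 1 and one transposition. If [u = v], then [e 3]
    is sent to [e 1]. *)
Lemma sum_row_group (l : seq I) (f : 'S_k.+4 -> C) : uniq l ->
  all (fun i => i \notin [:: e 1; e 2; e 3; e 4]) l ->
  \sum_(s in row_group (e 1 :: e 3 :: l) [:: e 2; e 4]) f s =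
  \sum_(u <- e 1 :: e 3 :: l) \sum_(v <- e 3 :: l)
    \sum_(h in Sym [set i in l])
      (f (h * tperm (e 3) v * tperm (e 1) u)%g +
       f (h * tperm (e 3) v * tperm (e 1) u * tperm (e 2) (e 4))%g).
Proof.
move=> ul /allP l4.
have l4F i : i \in [:: e 1; e 2; e 3; e 4] -> i \notin l.
  by apply: contraL => /l4.
have u3 : uniq (e 3 :: l) by rewrite /= l4F // !inE eqxx !orbT.
have u1 : uniq (e 1 :: e 3 :: l).
  by rewrite cons_uniq u3 inE pos_eq // l4F // !inE eqxx.
rewrite /row_group sum_mulg_Sym; last first.
  rewrite disjoint_subset; apply/subsetP => i; rewrite !inE /=.
  by case/or3P => [/eqP->|/eqP->|/l4]; rewrite ?pos_eq // !inE !negb_or;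
    case/and4P => _ -> _ ->.
rewrite !set_cons sum_SymU1; last first.
  by move: u1; rewrite cons_uniq => /andP[+ _]; rewrite !inE.
rewrite big_uniq //.
apply: eq_big => [u|u _]; first by rewrite !inE.
rewrite sum_SymU1; last by rewrite inE; case/andP: u3.
rewrite big_uniq //.
apply: eq_big => [v|v _]; first by rewrite !inE.
apply: eq_bigr => h _; rewrite set_nil setU0 sum_SymU1; last first.
  by rewrite inE pos_eq.
rewrite big_setU1 ?inE ?pos_eq // big_set1 !sum_Sym_le1 ?cards1 //.
by rewrite !mul1g tperm1 mulg1.
Qed.

Lemma tperm_columns :
  (tperm (e 1) (e 2) (e 1) = e 2) * (tperm (e 1) (e 2) (e 2) = e 1) *
  (tperm (e 1) (e 2) (e 3) = e 3) * (tperm (e 1) (e 2) (e 4) = e 4) *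
  (tperm (e 3) (e 4) (e 1) = e 1) * (tperm (e 3) (e 4) (e 2) = e 2) *
  (tperm (e 3) (e 4) (e 3) = e 4) * (tperm (e 3) (e 4) (e 4) = e 3).
Proof. by rewrite !tpermL !tpermR !tpermD ?pos_eq. Qed.

Lemma pact1 (f : fn) X : pact 1%g f X = f X.
Proof. by congr (f _); apply: eq_from_tnth => i; rewrite tnth_mktuple perm1. Qed.

Lemma altE i j (f : fn) X :
  alt i j f X = pact 1%g f X - pact (tperm (e i) (e j)) f X.
Proof. by rewrite pact1. Qed.

Lemma alt34_alt12 (f : fn) X :
  alt 1 2 (alt 3 4 f) X = pact 1%g f X - pact (tperm (e 1) (e 2)) f X
    - pact (tperm (e 3) (e 4)) f X + pact (tperm (e 3) (e 4) * tperm (e 1) (e 2))%g f X.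
Proof.
rewrite pact1 -pactM /alt {2}/pact opprD opprK addrA; congr (_ + _).
exact: addrAC.
Qed.

(** The columns and the second row move only the places 1 to 4. So it suffices to know the sum over
    the first row followed by any [s] fixing all other places; [psi] expresses it through the images
    of the four heads. *)
Lemma young_row (l : seq nat) (f : fn) X psi :
  uniq l -> all (fun i => 4 < i <= k.+4)%N l ->
  (forall s : 'S_k.+4, (forall i, i \notin [:: e 1; e 2; e 3; e 4] -> s i = i) ->
    \sum_(u <- e 1 :: e 3 :: map e l) \sum_(v <- e 3 :: map e l)
      \sum_(h in Sym [set i in map e l])
        pact (h * tperm (e 3) v * tperm (e 1) u * s)%g f X =
    psi (s (e 1)) (s (e 2)) (s (e 3)) (s (e 4))) ->
  young ([:: 1; 3]%N ++ l) [:: 2; 4]%N f X =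
    young4 (e 1) (e 2) (e 3) (e 4) psi.
Proof.
move=> ul /allP lk row.
have e_inj : {in l &, injective e}.
  move=> i j /lk /andP[i4 ik] /lk /andP[j4 jk] /eqP.
  by rewrite pos_eq ?ik ?jk ?(ltn_trans _ i4) ?(ltn_trans _ j4) // => /eqP.
have ue : uniq (map e l) by rewrite map_inj_in_uniq.
have l4 : all (fun i => i \notin [:: e 1; e 2; e 3; e 4]) (map e l).
  apply/allP => _ /mapP[i /lk /andP[i4 ik] ->].
  rewrite !inE !pos_eq ?ik ?(ltn_trans _ i4) //.
  by case: i i4 {ik} => [|[|[|[|[|]]]]].
have rowE (c : 'S_k.+4) : (forall i, i \notin [:: e 1; e 2; e 3; e 4] -> c i = i) ->
    row_sym (map e ([:: 1; 3]%N ++ l)) (map e [:: 2; 4]%N) f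
      [tuple tnth X (c i) | i < k.+4] =
    swap24 psi (c (e 1)) (c (e 2)) (c (e 3)) (c (e 4)).
  move=> cfix; rewrite /row_sym sum_row_group // /swap24 -row //.
  (* The transposition of the second row followed by [c] is again such an [s]; it yields the second
     term of [swap24]. *)
  have := row (tperm (e 2) (e 4) * c)%g; rewrite !permM.
  rewrite [tperm _ _ (e 1)]tpermD ?pos_eq // tpermL tpermR.
  rewrite [tperm _ _ (e 3)]tpermD ?pos_eq // => <-; last first.
    move=> i i4; rewrite permM tpermD ?cfix // eq_sym;
    by apply: contraNneq i4 => ->; rewrite !inE eqxx ?orbT.
  rewrite -big_split; apply: eq_bigr => u _.
  rewrite -big_split; apply: eq_bigr => v _.
  rewrite -big_split; apply: eq_bigr => h _.
  by rewrite !pactM !mulgA.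
have t12 i : i \notin [:: e 1; e 2] -> tperm (e 1) (e 2) i = i.
  by rewrite !inE negb_or => /andP[i1 i2]; rewrite tpermD // eq_sym.
have t34 i : i \notin [:: e 3; e 4] -> tperm (e 3) (e 4) i = i.
  by rewrite !inE negb_or => /andP[i3 i4]; rewrite tpermD // eq_sym.
have sub12 i : i \notin [:: e 1; e 2; e 3; e 4] -> i \notin [:: e 1; e 2].
  by rewrite !inE !negb_or => /and4P[-> ->].
have sub34 i : i \notin [:: e 1; e 2; e 3; e 4] -> i \notin [:: e 3; e 4].
  by rewrite !inE !negb_or => /and4P[_ _ -> ->].
have neq (s t : 'S_k.+4) i : s i != t i -> s != t by apply: contra_neq => ->.
(* Splitting the sum over the explicit column group requires its four elements to be distinct; their
   values at [e 1] or [e 3] show this. *)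
rewrite /young4 /young /col_sym col_group4 -!setUA !big_setU1 ?big_set1 /pact.
- rewrite !rowE //.
  + rewrite !permM !perm1 !tperm_columns odd_perm1 odd_mul_tperm !odd_tperm !pos_eq //=.
    by rewrite /col4 expr0 expr1 !mul1r !mulN1r !addrA.
  + by move=> i i4; rewrite permM t12 ?t34 ?sub12 ?sub34.
  + by move=> i /sub34/t34.
  + by move=> i /sub12/t12.
  + by move=> i _; rewrite perm1.
- by rewrite inE (neq _ _ (e 1)) // permM !tperm_columns pos_eq.
- rewrite !inE negb_or; apply/andP; split.
  + by rewrite (neq _ _ (e 1)) // !tperm_columns pos_eq.
  + by rewrite (neq _ _ (e 3)) // permM !tperm_columns pos_eq.
- rewrite !inE !negb_or; apply/and3P; split.
  + by rewrite (neq _ _ (e 1)) // perm1 tperm_columns pos_eq.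
  + by rewrite (neq _ _ (e 3)) // perm1 tperm_columns pos_eq.
  + by rewrite (neq _ _ (e 1)) // perm1 permM !tperm_columns pos_eq.
Qed.

End YoungSymmetrizer.

(** The pairs are sorted by the number of entries of [l] that move to the places of [e1] and [e3]:
    none, one or two. On the diagonal it is [e1] that goes to the place of [e3]. *)
Lemma sum_rows (V : zmodType) (T : eqType) (e1 e3 : T) (l : seq T)
    (g : T -> T -> V) : uniq l ->
  \sum_(u <- e1 :: e3 :: l) \sum_(v <- e3 :: l) g u v =
  g e1 e3 + g e3 e3 + \sum_(x <- l) (g e1 x + g e3 x + g x e3 + g x x)
  + \sum_(x <- l) \sum_(y <- l | x != y) g x y.
Proof.
move=> ul; rewrite !big_cons.
have -> : \sum_(x <- l) \sum_(v <- e3 :: l) g x v =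
    \sum_(x <- l) (g x e3 + g x x) + \sum_(x <- l) \sum_(y <- l | x != y) g x y.
  rewrite -big_split; apply: eq_big_seq => x xl; rewrite /= big_cons -addrA.
  congr (_ + _); rewrite (bigD1_seq x) //=; congr (_ + _).
  by apply: eq_bigl => y; rewrite eq_sym.
rewrite !big_split /= !addrA; congr (_ + _ + _ + _).
by rewrite -!addrA; congr (_ + _); rewrite addrCA.
Qed.

Lemma sum_neq_lt (V : zmodType) (l : seq nat) (f : nat -> nat -> V) :
  \sum_(i <- l) \sum_(j <- l | i != j) f i j =
  \sum_(i <- l) \sum_(j <- l | (i < j)%N) (f i j + f j i).
Proof.
have -> : \sum_(i <- l) \sum_(j <- l | (i < j)%N) (f i j + f j i) =
    \sum_(i <- l) \sum_(j <- l | (i < j)%N) f i j +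
    \sum_(i <- l) \sum_(j <- l | (j < i)%N) f i j.
  under eq_bigr => i _ do rewrite big_split.
  rewrite big_split; congr (_ + _).
  by rewrite (exchange_big_dep xpredT).
rewrite -big_split; apply: eq_bigr => i _ /=.
rewrite (bigID (fun j => i < j)%N) /=; congr (_ + _); apply: eq_bigl => j;
  by case: ltngtP.
Qed.

(** * Action of the transversal of the first row *)

Section ArrangedTransversals.
Context {T : finType} {V : zmodType}.
Variables (e1 e2 e3 e4 : T) (s : {perm T}).
Hypothesis heads_uniq : uniq [:: e1; e2; e3; e4].

(* [tperm e3 v * tperm e1 u] runs over the transversal that comes out of applying
   [sum_SymU1] twice; [s] is the part of the symmetrizer outside the first row. *)
Lemma transversal1 (F : T -> T -> T -> T -> T -> V) x
    (f := fun u v => let t := (tperm e3 v * tperm e1 u * s)%g in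
      F (t e1) (t e2) (t e3) (t e4) (t x))
    (a := s e1) (b := s e2) (c := s e3) (d := s e4) :
  x \notin [:: e1; e2; e3; e4] -> s x = x ->
  (f e1 e3 = F a b c d x) * (f e3 e3 = F c b a d x) *
  (f e1 x = F a b x d c) * (f e3 x = F c b x d a) *
  (f x e3 = F x b c d a) * (f x x = F x b a d c).
Proof.
move: heads_uniq; rewrite /= !inE !negb_or !andbT.
case/and3P => /and3P[e12 e13 e14] /andP[e23 e24] e34.
case/and4P; rewrite ![x == _]eq_sym => x1 x2 x3 x4 sx.
have t3x : (tperm e3 x e1 = e1) * (tperm e3 x e2 = e2) * (tperm e3 x e4 = e4).
  by do !split; rewrite tpermD // eq_sym.
have t13 : (tperm e1 e3 e2 = e2) * (tperm e1 e3 e4 = e4) * (tperm e1 e3 x = x).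
  by do !split; rewrite tpermD // eq_sym.
have t1x : (tperm e1 x e2 = e2) * (tperm e1 x e3 = e3) * (tperm e1 x e4 = e4).
  by do !split; rewrite tpermD // eq_sym.
by rewrite /f /= !permM !tperm1 !perm1 !(tpermL, tpermR, t3x, t13, t1x, sx).
Qed.

Lemma transversal2 (F : T -> T -> T -> T -> T -> T -> V) x y
    (t := (tperm e3 y * tperm e1 x * s)%g) :
  x \notin [:: e1; e2; e3; e4] -> y \notin [:: e1; e2; e3; e4] -> x != y ->
  s x = x -> s y = y ->
  F (t e1) (t e2) (t e3) (t e4) (t x) (t y) =
  F x (s e2) y (s e4) (s e1) (s e3).
Proof.
move: heads_uniq; rewrite /= !inE !negb_or !andbT.
case/and3P => /and3P[e12 e13 e14] /andP[e23 e24] e34.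
case/and4P; rewrite ![x == _]eq_sym => x1 x2 x3 x4.
case/and4P; rewrite ![y == _]eq_sym => y1 y2 y3 y4 xy sx sy.
have t3y : (tperm e3 y e1 = e1) * (tperm e3 y e2 = e2) * (tperm e3 y e4 = e4)
    * (tperm e3 y x = x).
  by do !split; rewrite tpermD // eq_sym.
have t1x : (tperm e1 x e2 = e2) * (tperm e1 x e3 = e3) * (tperm e1 x e4 = e4)
    * (tperm e1 x y = y).
  by do !split; rewrite tpermD // eq_sym.
by rewrite /t !permM !(tpermL, tpermR, t3y, t1x, sx, sy).
Qed.

Lemma transversal_fix x y z : z \notin [:: e1; e3; x; y] -> s z = z ->
  (tperm e3 y * tperm e1 x * s)%g z = z.
Proof.
rewrite !inE !negb_or => /and4P[z1 z3 zx zy] sz.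
by rewrite !permM !tpermD // eq_sym.
Qed.

End ArrangedTransversals.

Definition without (T : eqType) (l om : seq T) := [seq z <- l | z \notin om].

(** Jets ignore the order of their directions, so the directions that are moved can be gathered in
    front of the fixed ones. *)
Lemma perm_map_without (T : finType) (s : {perm T}) (l om : seq T) :
  uniq l -> uniq om -> {subset om <= l} ->
  {in without l om, forall z, s z = z} ->
  perm_eq (map s l) (map s om ++ without l om).
Proof.
move=> ul uom oml sfix; rewrite -(map_id_in sfix) -map_cat; apply: perm_map.
rewrite -(perm_filterC [in om]) perm_cat2r.
apply: uniq_perm; rewrite ?filter_uniq // => z; rewrite mem_filter /=.
by case: (boolP (z \in om)) => // /oml ->.
Qed.

(** * Curvature of the Levi-Civita connection *)

Lemma additive_opp (U V : zmodType) (f : U -> V) :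
  {morph f : x y / x + y} -> {morph f : x / - x}.
Proof.
move=> fD x; apply: (addIr (f x)); rewrite -fD !addNr.
by apply: (addIr (f 0)); rewrite -fD !add0r.
Qed.

Section Curvature.
Context {R : realType} {n : nat} {M : manifold R n}.
Local Notation C := (smoothfun M).
Local Notation V := (vfield M).

Lemma smoothfunE (f h : C) : (forall p, f p = h p) -> f = h.
Proof. by move=> fh; apply/val_inj/funext. Qed.

Lemma smoothfun_addE (f h : C) p : (f + h) p = f p + h p.
Proof. by []. Qed.

Lemma smoothfun_oppE (f : C) p : (- f) p = - f p.
Proof. by []. Qed.

Lemma smoothfun_zeroE p : (0 : C) p = 0.
Proof. by []. Qed.

Definition smoothfun_evalE := (smoothfun_addE, smoothfun_oppE, smoothfun_zeroE).

Lemma vfield_addE (X Y : V) p f : (X + Y) p f = X p f + Y p f.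
Proof. by []. Qed.

Lemma vfield_oppE (X : V) p f : (- X) p f = - X p f.
Proof. by []. Qed.

Lemma vfield_zeroE p f : (0 : V) p f = 0.
Proof. by []. Qed.

Definition vfield_evalE := (vfield_addE, vfield_oppE, vfield_zeroE).

Lemma actD (X : V) : {morph act X : f h / f + h}.
Proof. by move=> f h; rewrite -[f]scale1r act_linear !scale1r. Qed.

Lemma actN (X : V) : {morph act X : f / - f}.
Proof. exact/additive_opp/actD. Qed.

Lemma act_bracket (X Y : V) f :
  act (bracket X Y) f = act X (act Y f) - act Y (act X f).
Proof. exact: smoothfunE. Qed.

Lemma bracketC (X Y : V) : bracket Y X = - bracket X Y.
Proof. by apply: vfieldE => p f; rewrite vfield_oppE /= opprB. Qed.

Lemma jacobi (X Y Z : V) : bracket (bracket X Y) Z + bracket (bracket Y Z) X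
  + bracket (bracket Z X) Y = 0.
Proof.
apply: vfieldE => p f; rewrite !vfield_evalE.
rewrite -[bracket (bracket X Y) Z p f]/(act (bracket (bracket X Y) Z) f p).
rewrite -[bracket (bracket Y Z) X p f]/(act (bracket (bracket Y Z) X) f p).
rewrite -[bracket (bracket Z X) Y p f]/(act (bracket (bracket Z X) Y) f p).
rewrite !act_bracket !(actD, actN) !smoothfun_evalE; ring.
Qed.

Variables (g : metric M) (D : V -> V -> V).
Hypothesis hD : levi_civita g D.

Lemma innerDl (X Y Z : V) : inner g (X + Y) Z = inner g X Z + inner g Y Z.
Proof.
apply: smoothfunE => p; rewrite smoothfun_evalE /=.
by rewrite -[X p in LHS]scale1r metric_lin mul1r.
Qed.

Lemma innerC (X Y : V) : inner g X Y = inner g Y X.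
Proof. by apply: smoothfunE => p; exact: Defs.metric_sym. Qed.

Lemma innerDr (X Y Z : V) : inner g Z (X + Y) = inner g Z X + inner g Z Y.
Proof. by rewrite ![inner g Z _]innerC innerDl. Qed.

Lemma innerNl (X Y : V) : inner g (- X) Y = - inner g X Y.
Proof.
by apply: (additive_opp (f := (inner g)^~ Y)) => X1 X2; exact: innerDl.
Qed.

Lemma inner0l (X : V) : inner g 0 X = 0.
Proof. by apply: (addIr (inner g 0 X)); rewrite -innerDl !add0r. Qed.

Lemma nablaDl (X Y Z : V) : D (X + Y) Z = D X Z + D Y Z.
Proof. by have := nabla_linl hD 1 X Y Z; rewrite !scale1r. Qed.

Lemma nablaDr X : {morph D X : Y Z / Y + Z}.
Proof. exact: nabla_addr hD X. Qed.

Lemma nablaNr X : {morph D X : Y / - Y}.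
Proof. exact/additive_opp/nablaDr. Qed.

Lemma nablaNl (X Y : V) : D (- X) Y = - D X Y.
Proof. by apply: (additive_opp (f := D^~ Y)) => X1 X2; exact: nablaDl. Qed.

Definition curv_expand := (nablaDl, nablaDr, nablaNl, nablaNr).

Lemma bracketE (X Y : V) : bracket X Y = D X Y - D Y X.
Proof. by rewrite (nabla_torsion_free hD). Qed.

Lemma curvC (X Y Z : V) : curv D Y X Z = - curv D X Y Z.
Proof.
rewrite /curv bracketC nablaNl.
by apply: vfieldE => p f; rewrite !vfield_evalE; ring.
Qed.

Lemma curvDl (X X' Y Z : V) : curv D (X + X') Y Z = curv D X Y Z + curv D X' Y Z.
Proof.
rewrite /curv !bracketE !curv_expand.
by apply: vfieldE => p f; rewrite !vfield_evalE; ring.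
Qed.

Lemma curvDm (X Y Y' Z : V) : curv D X (Y + Y') Z = curv D X Y Z + curv D X Y' Z.
Proof. by rewrite ![curv D X _ _]curvC curvDl opprD. Qed.

Lemma curvDr (X Y Z Z' : V) : curv D X Y (Z + Z') = curv D X Y Z + curv D X Y Z'.
Proof.
rewrite /curv !curv_expand.
by apply: vfieldE => p f; rewrite !vfield_evalE; ring.
Qed.

(** Once torsion-freeness has eliminated the brackets, this is the Jacobi identity. *)
Lemma first_bianchi (X Y Z : V) :
  curv D X Y Z + curv D Y Z X + curv D Z X Y = 0.
Proof.
have := jacobi X Y Z; rewrite /curv !bracketE !curv_expand.
move=> J; apply: vfieldE => p f; move/(congr1 (fun W : V => W p f)): J.
by rewrite !vfield_evalE => J; rewrite -[RHS]oppr0 -J; ring.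
Qed.

(** The commutators of the operators [D U], [D X], [D Y] cancel cyclically; by torsion-freeness the
    remainder is the derivative of [Z] along the vanishing Jacobi sum. *)
Lemma second_bianchi_curv (U X Y Z : V) :
  (D U (curv D X Y Z) - curv D (D U X) Y Z - curv D X (D U Y) Z
    - curv D X Y (D U Z)) +
  (D X (curv D Y U Z) - curv D (D X Y) U Z - curv D Y (D X U) Z
    - curv D Y U (D X Z)) +
  (D Y (curv D U X Z) - curv D (D Y U) X Z - curv D U (D Y X) Z
    - curv D U X (D Y Z)) = 0.
Proof.
have := congr1 (D^~ Z) (jacobi U X Y); rewrite /curv !bracketE !curv_expand.
move=> J; apply: vfieldE => p f; move/(congr1 (fun W : V => W p f)): J.
rewrite -[D 0 Z](addrK (D 0 Z)) -nablaDl addr0 subrr.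
by rewrite !vfield_evalE => J; rewrite -[RHS]J; ring.
Qed.

(** The function [inner g Z W] is differentiated along [bracket X Y] directly and as a commutator,
    using metric compatibility; terms with one derivative on each factor cancel. *)
Lemma curv_inner_skew (X Y Z W : V) :
  inner g (curv D X Y Z) W = - inner g (curv D X Y W) Z.
Proof.
have m1 := nabla_metric hD.
have := act_bracket X Y (inner g Z W); rewrite !m1 !actD !m1 => /eqP.
rewrite -subr_eq0 => /eqP H; apply: smoothfunE => p.
have {H} := congr1 (fun f : C => f p) H.
rewrite /curv !(innerDl, innerNl) ![inner g Z _]innerC ![inner g (D _ Z) (D _ W)]innerC.
rewrite !smoothfun_evalE; lra.
Qed.

End Curvature.

(** * Iterated covariant derivatives *)

Lemma set_nth_cat (T : Type) (x0 : T) s t i y :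
  set_nth x0 (s ++ t) i y =
  if (i < size s)%N then set_nth x0 s i y ++ t
  else s ++ set_nth x0 t (i - size s) y.
Proof.
elim: s i => [|x s IH] [|i] //=.
by rewrite IH ltnS subSS; case: ifP.
Qed.

Section IteratedDerivatives.
Context {R : realType} {n : nat} {M : manifold R n}.
Local Notation C := (smoothfun M).
Local Notation V := (vfield M).
Variable D : V -> V -> V.

(* The same recursion as [nablak], with the derivative directions and the
   arguments of the tensor concatenated. *)
Fixpoint nabla_seq (T : seq V -> C) (k : nat) (s : seq V) : C :=
  match k, s with
  | k'.+1, Y :: s' => act Y (nabla_seq T k' s')
      - \sum_(i < size s') nabla_seq T k' (set_nth 0 s' i (D Y s'`_i))
  | _, _ => T s
  end.

(** In the concatenated list, directions and arguments are corrected alike, so the recursions merge.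
    The size bound keeps them from stopping early on an empty list. *)
Lemma nabla_seqD (T : seq V -> C) j k s : (j + k <= size s)%N ->
  nabla_seq (nabla_seq T k) j s = nabla_seq T (j + k) s.
Proof.
elim: j s => [|j IH] [|Y s] //= js; rewrite IH //.
congr (_ - _); apply: eq_bigr => i _; rewrite IH //.
by rewrite size_set_nth (maxn_idPr _).
Qed.

Lemma val_subst_arg m (Z : m.-tuple V) i Y :
  subst_arg Z i Y = set_nth 0 Z i Y :> seq V.
Proof.
apply: (@eq_from_nth _ 0) => [|j].
  by rewrite size_set_nth !size_tuple (maxn_idPr _).
rewrite size_tuple => jm; rewrite nth_set_nth -[j]/(val (Ordinal jm)).
by rewrite -tnth_nth tnth_mktuple (tnth_nth 0).
Qed.

Lemma nablakS m (T : tensor M m) k Y (W : k.-tuple V) Z :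
  nablak D T [tuple of Y :: W] Z = cov D Y (nablak D T W) Z
    - \sum_(i < k) nablak D T (subst_arg W i (D Y (tnth W i))) Z.
Proof.
have WE : [tuple of behead [tuple of Y :: W]] = W by exact: val_inj.
by rewrite -[in RHS]WE.
Qed.

(** The single sum over the concatenated list splits into the corrections of the directions, from
    [nablak], and those of the arguments, from [cov]. *)
Lemma nablak_seq m (T : tensor M m) (F : seq V -> C) k (W : k.-tuple V)
    (Z : m.-tuple V) : (forall Z : m.-tuple V, T Z = F Z) ->
  nablak D T W Z = nabla_seq F k (W ++ Z).
Proof.
move=> TF; elim: k W Z => [|k IH] W Z; first by rewrite tuple0 /= TF.
case/tupleP: W => Y W.
rewrite nablakS /cov IH /= size_cat !size_tuple big_split_ord /=.
rewrite opprD addrA addrAC; congr (_ - _ - _); apply: eq_bigr => i _.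
  rewrite IH val_subst_arg set_nth_cat nth_cat size_tuple ltnNge leq_addr /=.
  by rewrite addKn (tnth_nth 0).
by rewrite IH val_subst_arg set_nth_cat nth_cat size_tuple ltn_ord (tnth_nth 0).
Qed.

Definition tensor_seq m (T : tensor M m) (s : seq V) : C :=
  T [tuple nth 0 s i | i < m].

Lemma tensor_seqE m (T : tensor M m) (Z : m.-tuple V) : T Z = tensor_seq T Z.
Proof.
by congr T; apply: eq_from_tnth => i; rewrite tnth_mktuple (tnth_nth 0).
Qed.

Lemma nabla_seqE m (T : tensor M m) s (Z : m.-tuple V) :
  nabla D s T Z = nabla_seq (tensor_seq T) (size s) (s ++ Z).
Proof. exact/nablak_seq/tensor_seqE. Qed.

(** Innermost directions may be regarded as tensor arguments; this is what acting without the
    Leibniz rule amounts to. *)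
Lemma nabla_nablaT m (T : tensor M m) l s (W : (l + m).-tuple V) (Z : m.-tuple V)
    (w : seq V) : size w = l -> W = w ++ Z :> seq V ->
  nabla D s (nablaT D T l) W = nabla D (s ++ w) T Z.
Proof.
move=> wl WE.
rewrite [RHS]nabla_seqE /nabla (nablak_seq (F := nabla_seq (tensor_seq T) l)); last first.
  move=> Y; rewrite /nablaT (nablak_seq _ _ (tensor_seqE T)); congr nabla_seq.
  apply: (@eq_from_nth _ 0); rewrite size_cat !size_tuple // => i il.
  rewrite nth_cat size_tuple; case: ltnP => li.
    rewrite -[i]/(val (Ordinal li)) -tnth_nth tnth_mktuple (tnth_nth 0) //.
  have im : (i - l < m)%N by rewrite ltn_subLR.
  rewrite -[(i - l)%N]/(val (Ordinal im)) -tnth_nth tnth_mktuple (tnth_nth 0) /=.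
  by rewrite subnKC.
rewrite nabla_seqD; last by rewrite size_cat !size_tuple addnA leq_addr.
by rewrite WE size_cat wl catA.
Qed.

Lemma nabla_tuple m (T : tensor M m) k (W : k.-tuple V) Z :
  nabla D W T Z = nablak D T W Z.
Proof. by rewrite nabla_seqE (nablak_seq _ _ (tensor_seqE T)) size_tuple. Qed.

Lemma jet_tuple m (T : tensor M m) k (W : k.-tuple V) Z :
  jet D W T Z = (k`!%:R^-1 : R) *:
    \sum_(s : 'S_k) nablak D T [tuple tnth W (s i) | i < k] Z.
Proof.
(* [jet] is indexed by the size of its list; eliminating the equality with [k] identifies the two
   symmetric groups. *)
case: W => s sk; have e := eqP sk; case: _ / e in sk *.
by rewrite (eq_irrelevance sk (eqxx _)).
Qed.

(** Arranging the indices in [l] rather than the fields keeps the multiplicities right when fields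
    coincide. *)
Lemma jetE m (T : tensor M m) (U : eqType) (f : U -> V) (l : seq U) Z : uniq l ->
  jet D (map f l) T Z =
  ((size l)`!%:R^-1 : R) *: \sum_(r <- permutations l) nabla D (map f r) T Z.
Proof.
move=> ul; rewrite -[map f l]/(val (map_tuple f (in_tuple l))) jet_tuple.
congr (_ *: _).
rewrite -(sum_perm_tnth (t := in_tuple l) (fun r => nabla D (map f r) T Z)) //.
apply: eq_bigr => s _; rewrite -nabla_tuple; congr nabla.
by rewrite /= -map_comp; apply: eq_map => i /=; rewrite tnth_map.
Qed.

Definition rearrange m (t : m.-tuple 'I_m) (Z : m.-tuple V) : m.-tuple V :=
  [tuple tnth Z (tnth t i) | i < m].

(** The corrections run over all arguments, so a rearrangement merely reindexes their sum. *)
Lemma nablak_rearrange m (T : tensor M m) (t : m.-tuple 'I_m) k (W : k.-tuple V) Z :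
  uniq t ->
  nablak D (T \o rearrange t) W Z = nablak D T W (rearrange t Z).
Proof.
move=> /tuple_uniqP t_inj; elim: k W Z => [|k IH] W Z //.
case/tupleP: W => Y W; rewrite !nablakS /cov IH.
congr (_ - _ - _); last by apply: eq_bigr => i _; exact: IH.
rewrite (reindex_inj t_inj); apply: eq_bigr => i _; rewrite IH.
congr nablak; apply: eq_from_tnth => j; rewrite !tnth_mktuple.
by rewrite (inj_eq t_inj).
Qed.

Lemma nablakD m (T S : tensor M m) k (W : k.-tuple V) Z :
  nablak D (fun Z => T Z + S Z) W Z = nablak D T W Z + nablak D S W Z.
Proof.
elim: k W Z => [|k IH] W Z //.
case/tupleP: W => Y W; rewrite !nablakS /cov IH actD.
rewrite [RHS]addrACA [X in _ = X + _]addrACA -!opprD -!big_split.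
by congr (_ - _ - _); apply: eq_bigr => i _; exact: IH.
Qed.

Lemma nablakN m (T : tensor M m) k (W : k.-tuple V) Z :
  nablak D (fun Z => - T Z) W Z = - nablak D T W Z.
Proof.
elim: k W Z => [|k IH] W Z //.
case/tupleP: W => Y W; rewrite !nablakS /cov IH actN.
rewrite !opprD; congr (_ - _ - _); rewrite -sumrN;
  by apply: eq_bigr => i _; exact: IH.
Qed.

Lemma nablak0 m k (W : k.-tuple V) (Z : m.-tuple V) :
  nablak D (fun=> 0) W Z = 0.
Proof.
apply: (addIr (nablak D (fun=> 0) W Z)); rewrite add0r -nablakD.
by congr (nablak D _ W Z); apply/funext => Y; rewrite addr0.
Qed.

(** Covariant derivatives are additive and commute with rearrangements, so they inherit three-term
    identities; both Bianchi identities are carried over in this way. *)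
Lemma nablak_sum3 m (T : tensor M m) (t1 t2 : m.-tuple 'I_m) k (W : k.-tuple V) Z :
  uniq t1 -> uniq t2 ->
  (forall Z, T Z + T (rearrange t1 Z) + T (rearrange t2 Z) = 0) ->
  nablak D T W Z + nablak D T W (rearrange t1 Z)
    + nablak D T W (rearrange t2 Z) = 0.
Proof.
move=> u1 u2 T0; rewrite -!nablak_rearrange // -!nablakD -[RHS](nablak0 W Z).
by have -> : (fun=> 0) = fun Z => T Z + (T \o rearrange t1) Z
  + (T \o rearrange t2) Z by apply/funext => Y; rewrite /= T0.
Qed.

Lemma nablak_opp m (T : tensor M m) (t : m.-tuple 'I_m) k (W : k.-tuple V) Z :
  uniq t -> (forall Z, T (rearrange t Z) = - T Z) ->
  nablak D T W (rearrange t Z) = - nablak D T W Z.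
Proof.
move=> u TN; rewrite -nablak_rearrange // -nablakN.
by have -> : T \o rearrange t = fun Z => - T Z by exact/funext.
Qed.

Lemma nablak_sub m (T S : tensor M m) (t : m.-tuple 'I_m) k (W : k.-tuple V) Z :
  uniq t -> (forall Z, T Z = S Z - S (rearrange t Z)) ->
  nablak D T W Z = nablak D S W Z - nablak D S W (rearrange t Z).
Proof.
move=> u TS; rewrite -nablak_rearrange // -nablakN -nablakD.
by have -> : T = fun Z => S Z + - (S \o rearrange t) Z by exact/funext.
Qed.

End IteratedDerivatives.

(** * Symmetries of the derivatives of the curvature tensor *)

Lemma tuple4P (T : Type) (Z : 4.-tuple T) :
  exists a b c d, Z = [tuple a; b; c; d].
Proof.
case/tupleP: Z => a Z; case/tupleP: Z => b Z; case/tupleP: Z => c Z.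
case/tupleP: Z => d Z; rewrite (tuple0 Z).
by exists a, b, c, d; apply: val_inj.
Qed.

Section RiemannTensor.
Context {R : realType} {n : nat} {M : manifold R n}.
Local Notation C := (smoothfun M).
Local Notation V := (vfield M).
Variables (g : metric M) (D : V -> V -> V).
Hypothesis hD : levi_civita g D.
Local Notation Rm := (riemann D g).

Lemma riemannE a b c d : Rm [tuple a; b; c; d] = inner g (curv D a b c) d.
Proof. by []. Qed.

Lemma riemann_seqE a b c d :
  tensor_seq Rm [:: a; b; c; d] = inner g (curv D a b c) d.
Proof. by rewrite /tensor_seq /riemann !tnth_mktuple. Qed.

Lemma rearrange4 (i j k l : 'I_4) (a b c d : V) :
  rearrange [tuple i; j; k; l] [tuple a; b; c; d] =
  let x := tnth [tuple a; b; c; d] in [tuple x i; x j; x k; x l].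
Proof.
by apply: eq_from_tnth => -[[|[|[|[|m]]]] // im]; rewrite tnth_mktuple.
Qed.

Lemma nabla_riemann_curvature s p (f := fun a b c d : V =>
  nabla D s Rm [tuple a; b; c; d] p) : algebraic_curvature f.
Proof.
have skew (i j k l : 'I_4) : uniq [:: i; j; k; l] ->
    (forall Z, Rm (rearrange [tuple i; j; k; l] Z) = - Rm Z) ->
  forall a b c d (x := tnth [tuple a; b; c; d]),
    nabla D s Rm [tuple x i; x j; x k; x l] = - nabla D s Rm [tuple a; b; c; d].
  move=> ut skew a b c d x.
  by have := nablak_opp D (in_tuple s) [tuple a; b; c; d] ut skew; rewrite rearrange4.
split=> a b c d; rewrite /f -?smoothfun_oppE -?smoothfun_addE.
- rewrite -(skew 1 0 2 3) // => Z; have [? [? [? [? ->]]]] := tuple4P Z.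
  by rewrite rearrange4 !riemannE /= (curvC hD) innerNl.
- rewrite -(skew 0 1 3 2) // => Z; have [? [? [? [? ->]]]] := tuple4P Z.
  by rewrite rearrange4 !riemannE /= (curv_inner_skew hD).
pose t1 : 4.-tuple 'I_4 := [tuple 1; 2; 0; 3].
pose t2 : 4.-tuple 'I_4 := [tuple 2; 0; 1; 3].
have := nablak_sum3 (T := Rm) (t1 := t1) (t2 := t2) D (in_tuple s)
  [tuple a; b; c; d] isT isT.
rewrite !rearrange4 => -> // Z; have [? [? [? [? ->]]]] := tuple4P Z.
by rewrite !rearrange4 !riemannE -!innerDl (first_bianchi hD) inner0l.
Qed.

(** Metric compatibility cancels the correction in the last slot and moves the derivative onto the
    curvature field. *)
Lemma nablaT1_riemannE w a b c d :
  nablaT D Rm 1 [tuple w; a; b; c; d] =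
  inner g (D w (curv D a b c) - curv D (D w a) b c - curv D a (D w b) c
    - curv D a b (D w c)) d.
Proof.
rewrite -[LHS]/(nabla D [::] (nablaT D Rm 1) [tuple w; a; b; c; d]).
rewrite (nabla_nablaT D Rm [::] (Z := [tuple a; b; c; d]) (w := [:: w])) //.
rewrite nabla_seqE.
rewrite /= !big_ord_recl big_ord0 /= !riemann_seqE (nabla_metric hD).
rewrite !(innerDl, innerNl).
by apply: smoothfunE => p; rewrite !smoothfun_evalE; ring.
Qed.

Lemma nabla_rcons s w a b c d : nabla D (rcons s w) Rm [tuple a; b; c; d] =
  nabla D s (nablaT D Rm 1) [tuple w; a; b; c; d].
Proof. by rewrite -cats1; apply/esym/nabla_nablaT. Qed.

(** The second Bianchi identity is a cyclic relation in the first three arguments of the field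
    [nablaT D Rm 1], so the outer derivatives [s] preserve it. *)
Lemma nabla_riemann_bianchi s p (Q := fun w a b c d : V =>
  nabla D (rcons s w) Rm [tuple a; b; c; d] p) : second_bianchi Q.
Proof.
move=> w a b c d; rewrite /Q !nabla_rcons.
pose t1 : 5.-tuple 'I_5 := [tuple 1; 2; 0; 3; 4].
pose t2 : 5.-tuple 'I_5 := [tuple 2; 0; 1; 3; 4].
have t1E w' a' b' c' d' : rearrange t1 [tuple w'; a'; b'; c'; d'] =
    [tuple a'; b'; w'; c'; d'] :> 5.-tuple V.
  by apply: eq_from_tnth => -[[|[|[|[|[|m]]]]] // im]; rewrite tnth_mktuple.
have t2E w' a' b' c' d' : rearrange t2 [tuple w'; a'; b'; c'; d'] =
    [tuple b'; w'; a'; c'; d'] :> 5.-tuple V.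
  by apply: eq_from_tnth => -[[|[|[|[|[|m]]]]] // im]; rewrite tnth_mktuple.
have := nablak_sum3 (T := nablaT D Rm 1) (t1 := t1) (t2 := t2) D (in_tuple s)
  [tuple w; a; b; c; d] isT isT.
rewrite t1E t2E -!smoothfun_addE /nabla => -> // Z; case/tupleP: Z => w' Z.
have [a' [b' [c' [d' ->]]]] := tuple4P Z.
have -> : [tuple of w' :: [tuple a'; b'; c'; d']] = [tuple w'; a'; b'; c'; d'].
  exact: val_inj.
by rewrite t1E t2E !nablaT1_riemannE -!innerDl (second_bianchi_curv hD) inner0l.
Qed.

Lemma ricci_identity U W a b c d :
  curv_act D Rm [tuple U; W; a; b; c; d] =
  nabla D [:: U; W] Rm [tuple a; b; c; d] - nabla D [:: W; U] Rm [tuple a; b; c; d].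
Proof.
rewrite !nabla_seqE /= !big_ord_recl !big_ord0 /= !big_ord_recl !big_ord0 /=.
pose r x y z t := tensor_seq Rm [:: x; y; z; t].
have r1 x y b' c' d' : r (x + y) b' c' d' = r x b' c' d' + r y b' c' d'.
  by rewrite /r !riemann_seqE (curvDl hD) innerDl.
have r2 a' x y c' d' : r a' (x + y) c' d' = r a' x c' d' + r a' y c' d'.
  by rewrite /r !riemann_seqE (curvDm hD) innerDl.
have r3 a' b' x y d' : r a' b' (x + y) d' = r a' b' x d' + r a' b' y d'.
  by rewrite /r !riemann_seqE (curvDr hD) innerDl.
have r4 a' b' c' x y : r a' b' c' (x + y) = r a' b' c' x + r a' b' c' y.
  by rewrite /r !riemann_seqE innerDr.
have rN1 x b' c' d' : r (- x) b' c' d' = - r x b' c' d'.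
  by apply: (additive_opp (f := fun x => r x b' c' d')) => ? ?; exact: r1.
have rN2 a' x c' d' : r a' (- x) c' d' = - r a' x c' d'.
  by apply: (additive_opp (f := fun x => r a' x c' d')) => ? ?; exact: r2.
have rN3 a' b' x d' : r a' b' (- x) d' = - r a' b' x d'.
  by apply: (additive_opp (f := fun x => r a' b' x d')) => ? ?; exact: r3.
have rN4 a' b' c' x : r a' b' c' (- x) = - r a' b' c' x.
  by apply: (additive_opp (f := fun x => r a' b' c' x)) => ? ?; exact: r4.
have -> : curv_act D Rm [tuple U; W; a; b; c; d] = - (r (curv D U W a) b c d
    + r a (curv D U W b) c d + r a b (curv D U W c) d + r a b c (curv D U W d)).
  rewrite /curv_act.
  have -> : [tuple tnth [tuple U; W; a; b; c; d] (rshift 2 i) | i < 4] =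
      [tuple a; b; c; d].
    by apply: eq_from_tnth => -[[|[|[|[|m]]]] // im]; rewrite tnth_mktuple.
  rewrite !big_ord_recl big_ord0 addr0 !addrA.
  by rewrite !(tensor_seqE Rm) !val_subst_arg.
rewrite -!/(r _ _ _ _) /curv (bracketE hD) !(curv_expand hD).
rewrite !(r1, r2, r3, r4, rN1, rN2, rN3, rN4).
(* Torsion-freeness expresses the commutator on scalars by the derivatives along [D U W] and
   [D W U], which are exactly the corrections of the direction slots. *)
have B : act U (act W (r a b c d)) = act W (act U (r a b c d))
    + act (D U W) (r a b c d) - act (D W U) (r a b c d).
  apply/eqP; rewrite -addrA addrC -subr_eq -act_bracket (bracketE hD); apply/eqP.
  exact: smoothfunE.
rewrite !addr0 !(actD, actN) B.
by apply: smoothfunE => p; rewrite !smoothfun_evalE; ring.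
Qed.

Lemma nabla_rcons2 s u w a b c d :
  nabla D (rcons (rcons s u) w) Rm [tuple a; b; c; d] =
  nabla D s (nablaT D Rm 2) [tuple u; w; a; b; c; d].
Proof. by rewrite -!cats1 -catA; apply/esym/nabla_nablaT. Qed.

(** The Ricci term is [nablaT D Rm 2] minus its swap in the first two arguments, and the outer
    derivatives commute with this swap. *)
Lemma nabla_curv_act s u w a b c d :
  nabla D s (curv_act D Rm) [tuple u; w; a; b; c; d] =
  nabla D (rcons (rcons s u) w) Rm [tuple a; b; c; d] -
  nabla D (rcons (rcons s w) u) Rm [tuple a; b; c; d].
Proof.
rewrite !nabla_rcons2.
pose t : 6.-tuple 'I_6 := [tuple 1; 0; 2; 3; 4; 5].
have tE u' w' a' b' c' d' : rearrange t [tuple u'; w'; a'; b'; c'; d'] =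
    [tuple w'; u'; a'; b'; c'; d'] :> 6.-tuple V.
  by apply: eq_from_tnth => -[[|[|[|[|[|[|m]]]]]] // im]; rewrite tnth_mktuple.
have := nablak_sub (T := curv_act D Rm) (S := nablaT D Rm 2) (t := t) D
  (in_tuple s) [tuple u; w; a; b; c; d] isT.
rewrite tE /nabla => -> // Z; case/tupleP: Z => u' Z; case/tupleP: Z => w' Z.
have [a' [b' [c' [d' ->]]]] := tuple4P Z.
have -> : [tuple of u' :: [tuple of w' :: [tuple a'; b'; c'; d']]] =
  [tuple u'; w'; a'; b'; c'; d'] by exact: val_inj.
rewrite tE ricci_identity -[[:: u'; w']]/(rcons (rcons [::] u') w').
by rewrite -[[:: w'; u']]/(rcons (rcons [::] w') u') !nabla_rcons2.
Qed.

End RiemannTensor.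

(** * Jets of the curvature tensor *)

Section Evaluation.
Context {R : realType} {n : nat} {M : manifold R n}.
Local Notation C := (smoothfun M).

Lemma smoothfun_sumE (I : Type) (r : seq I) (P : pred I) (F : I -> C) p :
  (\sum_(i <- r | P i) F i) p = \sum_(i <- r | P i) F i p.
Proof. by apply: (big_morph (fun f : C => f p)). Qed.

Lemma smoothfun_mulE (f h : C) p : (f * h) p = f p * h p.
Proof. by []. Qed.

Lemma smoothfun_scaleE (c : R) (f : C) p : (c *: f) p = c * f p.
Proof. by []. Qed.

Lemma smoothfun_natE m p : (m%:R : C) p = m%:R.
Proof. by elim: m => // m IH; rewrite -!natr1 smoothfun_addE IH. Qed.

Lemma young_at (T : Type) N a b (f : N.+1.-tuple T -> C) X p :
  (young a b f X) p = young a b (fun Y => f Y p) X.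
Proof.
rewrite /young /col_sym smoothfun_sumE; apply: eq_bigr => s _.
rewrite smoothfun_mulE; congr (_ * _); first by case: (odd_perm s).
by rewrite /row_sym /pact smoothfun_sumE.
Qed.

End Evaluation.

Section Proposition.
Context {R : realType} {n : nat} {M : manifold R n}.
Variables (g : metric M) (D : vfield M -> vfield M -> vfield M).
Hypothesis hD : levi_civita g D.
Variables (p : M) (k : nat) (X : k.+4.-tuple (vfield M)).
Local Notation C := (smoothfun M).
Local Notation V := (vfield M).
Local Notation I := 'I_k.+4.
Local Notation e := (@pos k.+3).
Local Notation Rm := (riemann D g).
Local Notation Z := (map e (iota 5 k)).

(** Vectors are represented by their places in [X], so that lists stay duplicate-free and
    permutations act on them even when fields coincide. *)
Definition nabla_at (l : seq I) (a b c d : I) : R :=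
  nabla D (map (tnth X) l) Rm [tuple tnth X a; tnth X b; tnth X c; tnth X d] p.

Definition jet_at l a b c d := av l (fun r => nabla_at r a b c d).

(* [w], respectively [v] and [w], are innermost and not symmetrized with [l]. *)
Definition jet1_at l w a b c d := av l (fun r => nabla_at (rcons r w) a b c d).

Definition jet2_at l v w a b c d :=
  av l (fun r => nabla_at (rcons (rcons r v) w) a b c d).

Lemma nabla_at_curvature l : algebraic_curvature (nabla_at l).
Proof.
have [h1 h2 h3] := nabla_riemann_curvature hD (map (tnth X) l) p.
by split=> a b c d; [exact: h1|exact: h2|exact: h3].
Qed.

Lemma av_curvature l (q : seq I -> I -> I -> I -> I -> R) :
  (forall r, algebraic_curvature (q r)) ->
  algebraic_curvature (fun a b c d => av l (fun r => q r a b c d)).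
Proof.
move=> qc; split=> a b c d.
- by rewrite -avN; apply: eq_av => r; have [-> _ _] := qc r.
- by rewrite -avN; apply: eq_av => r; have [_ -> _] := qc r.
- by rewrite -!avD -(av0 l); apply: eq_av => r; have [_ _ ->] := qc r.
Qed.

Lemma jet1_curvature l w : algebraic_curvature (jet1_at l w).
Proof. by apply: av_curvature => r; exact: nabla_at_curvature. Qed.

Lemma jet_curvature l : algebraic_curvature (jet_at l).
Proof. by apply: av_curvature => r; exact: nabla_at_curvature. Qed.

Lemma jet2_curvature l v w : algebraic_curvature (jet2_at l v w).
Proof. by apply: av_curvature => r; exact: nabla_at_curvature. Qed.

Lemma jet1_bianchi l : second_bianchi (jet1_at l).
Proof.
move=> w a b c d; rewrite -!avD -(av0 l); apply: eq_av => r.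
rewrite /nabla_at !map_rcons; exact: nabla_riemann_bianchi.
Qed.

Lemma jet2_bianchi l v : second_bianchi (jet2_at l v).
Proof.
move=> w a b c d; rewrite -!avD -(av0 l); apply: eq_av => r.
rewrite /nabla_at !map_rcons; exact: nabla_riemann_bianchi.
Qed.

Lemma jet_rcons l a b c d : uniq l ->
  (size l)%:R * jet_at l a b c d =
  \sum_(x <- l) jet1_at (without l [:: x]) x a b c d.
Proof.
move=> ul; rewrite /jet_at av_rcons //; apply: eq_bigr => x _.
by congr av; apply: eq_filter => z; rewrite inE.
Qed.

Lemma jet1_rcons l w a b c d : uniq l ->
  (size l)%:R * jet1_at l w a b c d =
  \sum_(x <- l) jet2_at (without l [:: x]) x w a b c d.
Proof.
move=> ul; rewrite /jet1_at av_rcons //; apply: eq_bigr => x _.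
by congr av; apply: eq_filter => z; rewrite inE.
Qed.

(** First [y] is split off as innermost direction, then [x] from the remaining ones. *)
Lemma jet2_rcons l a b c d : uniq l ->
  \sum_(x <- l) \sum_(y <- l | x != y) jet2_at (without l [:: x; y]) x y a b c d
  = (size l * (size l).-1)%N%:R * jet_at l a b c d.
Proof.
move=> ul; rewrite mulnC natrM -mulrA jet_rcons // big_distrr.
rewrite (exchange_big_dep xpredT) //=; apply: eq_big_seq => y yl.
have sz : size (without l [:: y]) = (size l).-1.
  rewrite -(size_rem yl) rem_filter //; congr size; apply: eq_filter => z.
  by rewrite inE.
rewrite -sz jet1_rcons ?filter_uniq // big_filter.
apply: eq_big => [x|x xy]; first by rewrite inE.
by congr jet2_at; rewrite /without -filter_predI; apply: eq_filter => z;
  rewrite !inE negb_or.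
Qed.

Lemma eq_jet_at l l' a b c d : perm_eq l l' -> jet_at l a b c d = jet_at l' a b c d.
Proof. exact: av_perm. Qed.

Lemma jetE_at l a b c d : uniq l ->
  jet D (map (tnth X) l) Rm [tuple tnth X a; tnth X b; tnth X c; tnth X d] p =
  jet_at l a b c d.
Proof. by move=> ul; rewrite jetE // smoothfun_scaleE smoothfun_sumE. Qed.

Lemma jet1E_at l w a b c d : uniq l ->
  jet D (map (tnth X) l) (nablaT D Rm 1)
    [tuple tnth X w; tnth X a; tnth X b; tnth X c; tnth X d] p =
  jet1_at l w a b c d.
Proof.
move=> ul; rewrite jetE // smoothfun_scaleE smoothfun_sumE; congr (_ * _).
by apply: eq_bigr => r _; rewrite -nabla_rcons /nabla_at map_rcons.
Qed.

Lemma jet2E_at l v w a b c d : uniq l ->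
  jet D (map (tnth X) l) (nablaT D Rm 2)
    [tuple tnth X v; tnth X w; tnth X a; tnth X b; tnth X c; tnth X d] p =
  jet2_at l v w a b c d.
Proof.
move=> ul; rewrite jetE // smoothfun_scaleE smoothfun_sumE; congr (_ * _).
by apply: eq_bigr => r _; rewrite -nabla_rcons2 /nabla_at !map_rcons.
Qed.

Lemma jet_curv_actE_at l v w a b c d : uniq l ->
  jet D (map (tnth X) l) (curv_act D Rm)
    [tuple tnth X v; tnth X w; tnth X a; tnth X b; tnth X c; tnth X d] p =
  jet2_at l v w a b c d - jet2_at l w v a b c d.
Proof.
move=> ul; rewrite jetE // smoothfun_scaleE smoothfun_sumE -mulrBr -sumrB.
congr (_ * _); apply: eq_bigr => r _.
by rewrite (nabla_curv_act hD) /nabla_at !map_rcons.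
Qed.

(** * Evaluation of the symmetrizers *)

Local Notation act_on s := [tuple tnth X (s i) | i < k.+4].

Lemma hatE s (om : seq nat) : all (fun i => 0 < i <= k.+4)%N om ->
  hat (act_on s) om = map (tnth X) (map s (without Z (map e om))).
Proof.
move=> /allP omk; rewrite /hat -map_comp /without filter_map -map_comp.
rewrite (_ : [seq i <- iota 5 k | i \notin om] =
  [seq i <- iota 5 k | e i \notin map e om]).
  by apply: eq_map => i /=; rewrite /arg tnth_mktuple.
apply: eq_in_filter => i; rewrite mem_iota => /andP[i5 ik] /=; congr (~~ _).
apply/idP/mapP => [iom|[j jom /eqP]]; first by exists i.
have jk := omk _ jom; have ik' : (0 < i <= k.+4)%N by lia.
by rewrite pos_eq // => /eqP->.
Qed.

Lemma tail_uniq : uniq Z.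
Proof.
rewrite map_inj_in_uniq ?iota_uniq // => i j; rewrite !mem_iota => ik jk /eqP.
by rewrite pos_eq => [/eqP //||]; lia.
Qed.

Lemma tail_notin : {in Z, forall x, x \notin [:: e 1; e 2; e 3; e 4]}.
Proof.
move=> _ /mapP[i + ->]; rewrite mem_iota => ik.
by rewrite !inE !pos_eq; lia.
Qed.

Lemma pact_jet (s : {perm I}) om a b c d : all (fun i => 0 < i <= k.+4)%N om ->
  pact s (fun Y => jet D (hat Y om) Rm [tuple Y$a; Y$b; Y$c; Y$d] p) X =
  jet_at (map s (without Z (map e om))) (s (e a)) (s (e b)) (s (e c)) (s (e d)).
Proof.
move=> omk; rewrite /pact hatE // /arg !tnth_mktuple jetE_at //.
by rewrite map_inj_uniq ?filter_uniq ?tail_uniq //; exact: perm_inj.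
Qed.

(* The row sum of the tableau with first row [1 3 A], where [x] is the index of
   [X_A] and the last argument of [F] is the vector standing at its place. *)
Definition mixed (F : I -> I -> I -> I -> I -> R) x a b c d : R :=
  F a b c d x + F c b a d x +
  (F a b x d c + F c b x d a + F x b c d a + F x b a d c).

Lemma heads_uniq : uniq [:: e 1; e 2; e 3; e 4].
Proof. by rewrite /= !inE !pos_eq. Qed.

Lemma young_13 (f : k.+4.-tuple V -> R) F :
  (forall s : {perm I}, {in Z, forall z, s z = z} ->
    pact s f X = F (s (e 1)) (s (e 2)) (s (e 3)) (s (e 4))) ->
  young [:: 1; 3]%N [:: 2; 4]%N f X =
  young4 (e 1) (e 2) (e 3) (e 4) (fun a b c d => F a b c d + F c b a d).
Proof.
move=> fF; apply: (@young_row _ _ k [::]) => // s sfix.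
rewrite !big_cons !big_nil !addr0 set_nil !sum_Sym_le1 ?cards0 //.
rewrite !mul1g !tperm1 !mul1g !fF ?permM ?tpermL ?tpermR ?tpermD ?pos_eq //.
  move=> z /tail_notin z4; rewrite permM tpermD ?sfix // eq_sym;
  by apply: contraNneq z4 => ->; rewrite !inE eqxx ?orbT.
by move=> z /tail_notin/sfix.
Qed.

(** The first row has six permutations, and besides the four heads only the vector at the place of
    [e i] is affected. *)
Lemma young_13i (f : k.+4.-tuple V -> R) F i : (4 < i <= k.+4)%N ->
  (forall s : {perm I}, {in without Z [:: e i], forall z, s z = z} ->
    pact s f X = F (s (e 1)) (s (e 2)) (s (e 3)) (s (e 4)) (s (e i))) ->
  young [:: 1; 3; i]%N [:: 2; 4]%N f X =
  young4 (e 1) (e 2) (e 3) (e 4) (mixed F (e i)).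
Proof.
move=> ik fF; have iZ : e i \in Z by rewrite map_f // mem_iota; lia.
apply: (@young_row _ _ k [:: i]) => //= [|s sfix]; first by rewrite ik.
rewrite set_cons set_nil setU0; under eq_bigr => u _.
  under eq_bigr => v _ do rewrite sum_Sym_le1 ?cards1 // mul1g.
  over.
rewrite sum_rows // !big_cons !big_nil eqxx !addr0.
have [[[[[h1 h2] h3] h4] h5] h6] :=
  transversal1 heads_uniq F (tail_notin iZ) (sfix _ (tail_notin iZ)).
have fE u v : u \in [:: e 1; e 3; e i] -> v \in [:: e 1; e 3; e i] ->
    pact (tperm (e 3) v * tperm (e 1) u * s)%g f X =
    let t := (tperm (e 3) v * tperm (e 1) u * s)%g in
    F (t (e 1)) (t (e 2)) (t (e 3)) (t (e 4)) (t (e i)).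
  move=> uP vP; apply: fF => z; rewrite mem_filter inE => /andP[zi zZ].
  have z4 := tail_notin zZ; apply: transversal_fix (sfix _ z4).
  have zP w : w \in [:: e 1; e 3; e i] -> z != w.
    apply: contraTneq => <-; rewrite !inE !negb_or zi andbT.
    by move: z4; rewrite !inE !negb_or => /and4P[-> _ -> _].
  by rewrite !inE !negb_or !zP // !inE eqxx ?orbT.
by rewrite !fE ?inE ?eqxx ?orbT // h1 h2 h3 h4 h5 h6.
Qed.

(** The vector [y] replaces [x] among the directions. *)
Definition jet_without x a b c d y := jet_at (y :: without Z [:: x]) a b c d.

(** The vectors [x] and [y] have entered the first and third curvature slots, displacing [a] and [c]
    into the directions. *)
Definition jet_pair x y a b c d := jet_at (a :: c :: without Z [:: x; y]) x b y d.

(** The sum over the first row of the full tableau, divided by [k!] and sorted as in [sum_rows]. *)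
Definition full_row a b c d : R :=
  jet_at Z a b c d + jet_at Z c b a d +
  \sum_(x <- Z) (jet_without x a b x d c + jet_without x c b x d a +
                 jet_without x x b c d a + jet_without x x b a d c) +
  \sum_(x <- Z) \sum_(y <- Z | x != y) jet_pair x y a b c d.

Lemma jet_at_map (s : {perm I}) om a b c d : uniq om -> {subset om <= Z} ->
  {in without Z om, forall z, s z = z} ->
  jet_at (map s Z) a b c d = jet_at (map s om ++ without Z om) a b c d.
Proof.
by move=> uom omZ sfix; apply/eq_jet_at/perm_map_without/sfix; rewrite ?tail_uniq.
Qed.

(** For fixed [t], the factor [h] permutes the derivative directions only, so the sum over it
    symmetrizes them. *)
Lemma sum_Sym_nabla (t : {perm I}) :
  \sum_(h in Sym [set i in Z]) pact (h * t)%g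
     (fun Y => nabla D (hat Y [::]) Rm [tuple Y$1; Y$2; Y$3; Y$4] p) X =
  k`!%:R * jet_at (map t Z) (t (e 1)) (t (e 2)) (t (e 3)) (t (e 4)).
Proof.
rewrite /jet_at /av size_map size_map size_iota mulVKf; last first.
  by rewrite pnatr_eq0 -lt0n fact_gt0.
rewrite (perm_big _ (perm_permutations_map t Z)) big_map -sum_Sym_map ?tail_uniq //.
apply: eq_bigr => h hZ; have hfix i : i \in [:: e 1; e 2; e 3; e 4] -> h i = i.
  move=> i4; apply: (Sym_out hZ); rewrite inE; apply: contraL i4; exact: tail_notin.
rewrite /pact hatE // /arg !tnth_mktuple !permM !hfix ?inE ?eqxx ?orbT //.
rewrite /nabla_at /= /without filter_predT -!map_comp.
congr (nabla D _ _ _ _); apply: eq_map => i /=; by rewrite permM.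
Qed.

Lemma young_nabla :
  young ([:: 1; 3]%N ++ iota 5 k) [:: 2; 4]%N
    (fun Y => nabla D (hat Y [::]) Rm [tuple Y$1; Y$2; Y$3; Y$4] p) X =
  young4 (e 1) (e 2) (e 3) (e 4) (fun a b c d => k`!%:R * full_row a b c d).
Proof.
apply: young_row; first exact: iota_uniq.
  by apply/allP => i; rewrite mem_iota; lia.
move=> s sfix; pose t u v := (tperm (e 3) v * tperm (e 1) u * s)%g.
pose G u v := let q := t u v in
  jet_at (map q Z) (q (e 1)) (q (e 2)) (q (e 3)) (q (e 4)).
transitivity (k`!%:R * \sum_(u <- e 1 :: e 3 :: Z) \sum_(v <- e 3 :: Z) G u v).
  rewrite big_distrr; apply: eq_bigr => u _; rewrite big_distrr.
  apply: eq_bigr => v _; rewrite /= -sum_Sym_nabla; apply: eq_bigr => h _.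
  by rewrite /t !mulgA.
congr (_ * _); rewrite sum_rows ?tail_uniq // /full_row.
have sZ : {in Z, forall z, s z = z} by move=> z /tail_notin/sfix.
(* Of the directions, only those in [om] are displaced by the transversal elements; the jets can
   then be compared up to order. *)
have fixZ u' v' om : {subset [:: u'; v'] <= [:: e 1, e 3 & om]} ->
    {in without Z om, forall z, t u' v' z = z}.
  move=> uv z; rewrite mem_filter => /andP[zom zZ].
  have z4 := tail_notin zZ; apply: transversal_fix (sfix _ z4).
  have zP w : w \in [:: e 1, e 3 & om] -> z != w.
    apply: contraTneq => <-; rewrite !inE !negb_or zom andbT.
    by move: z4; rewrite !inE !negb_or => /and4P[-> _ -> _].
  have [ue ve] : u' \in [:: e 1, e 3 & om] /\ v' \in [:: e 1, e 3 & om].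
    by split; apply: uv; rewrite !inE eqxx ?orbT.
  by rewrite !inE !negb_or !zP // !inE eqxx ?orbT.
have G1 u' v' x : x \in Z -> {subset [:: u'; v'] <= [:: e 1; e 3; x]} ->
    G u' v' = let q := t u' v' in
      jet_without x (q (e 1)) (q (e 2)) (q (e 3)) (q (e 4)) (q x).
  move=> xZ uv; rewrite /G /= (jet_at_map (om := [:: x])) //.
    by move=> z; rewrite inE => /eqP->.
  exact: fixZ.
congr (_ + _ + _ + _).
- by rewrite /G /t !tperm1 !mul1g map_id_in.
- rewrite /G /= map_id_in; last first.
    move=> z zZ; apply: (fixZ _ _ [::]); last by rewrite mem_filter.
    by move=> w; rewrite !inE => /orP[]/eqP->; rewrite eqxx orbT.
  by rewrite /t tperm1 mul1g !permM tpermL tpermR !tpermD ?pos_eq.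
- apply: eq_big_seq => x xZ.
  have [[[[[_ _] h3] h4] h5] h6] :=
    transversal1 heads_uniq (jet_without x) (tail_notin xZ) (sZ _ xZ).
  by rewrite !(G1 _ _ x) // ?h3 ?h4 ?h5 ?h6 // => z; rewrite !inE;
    do ![case/orP] => /eqP->; rewrite eqxx ?orbT.
apply: eq_big_seq => x xZ; rewrite big_seq_cond [RHS]big_seq_cond.
apply: eq_bigr => y /andP[yZ xy].
rewrite /G /= (jet_at_map (om := [:: x; y])).
- pose F a b c d u v := jet_at ([:: u; v] ++ without Z [:: x; y]) a b c d.
  exact: (transversal2 heads_uniq F (tail_notin xZ) (tail_notin yZ) xy
    (sZ _ xZ) (sZ _ yZ)).
- by rewrite /= inE xy.
- by move=> z; rewrite !inE => /orP[]/eqP->.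
- by apply: fixZ => z; rewrite !inE => /orP[]/eqP->; rewrite eqxx ?orbT.
Qed.

Local Notation young4e := (young4 (e 1) (e 2) (e 3) (e 4)).

Lemma young_jet_mixed i (x := e i) : i \in iota 5 k ->
  young [:: 1; 3; i]%N [:: 2; 4]%N (fun Y : k.+4.-tuple V =>
     (jet D (hat Y [::]) Rm [tuple Y$1; Y$2; Y$3; Y$4]
      - jet D (hat Y [:: i]) (nablaT D Rm 1)
          [tuple Y$i; Y$1; Y$2; Y$3; Y$4]) p) X =
  young4e (mixed (jet_without x) x)
  - 24 * jet1_at (without Z [:: x]) x (e 1) (e 2) (e 3) (e 4).
Proof.
rewrite mem_iota => i5; have ik : (4 < i <= k.+4)%N by lia.
have ik' : (0 < i <= k.+4)%N by lia.
have xZ : x \in Z by rewrite map_f // mem_iota.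
pose F1 a b c d y := jet1_at (without Z [:: x]) y a b c d.
rewrite (young_13i (F := fun a b c d y => jet_without x a b c d y - F1 a b c d y) ik).
  (* The row sum of the subtracted term is exactly the expression in [young4_nabla] for [w = x]. *)
  have F1c v := jet1_curvature (without Z [:: x]) v.
  rewrite -(young4_nabla _ _ _ _ _ F1c (jet1_bianchi _)) -young4B.
  apply: eq_young4 => a b c d; rewrite /mixed /F1; ring.
move=> s sfix; rewrite /pact smoothfun_addE smoothfun_oppE.
have := pact_jet s (om := [::]) 1 2 3 4 isT; rewrite /pact => ->.
rewrite [without Z [::]]filter_predT (jet_at_map (om := [:: x])) //; last first.
  by move=> z; rewrite inE => /eqP->.
congr (_ - _); rewrite hatE; last by rewrite /= ik'.
rewrite /arg !tnth_mktuple jet1E_at.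
  by rewrite /F1 (map_id_in sfix).
by rewrite map_inj_uniq ?filter_uniq ?tail_uniq //; exact: perm_inj.
Qed.

Lemma young_jet_pair i j (x := e i) (y := e j) :
  i \in iota 5 k -> j \in iota 5 k -> (i < j)%N ->
  young [:: 1; 3]%N [:: 2; 4]%N (fun Y : k.+4.-tuple V =>
     (jet D ([:: Y$1; Y$3] ++ hat Y [:: i; j]) Rm [tuple Y$i; Y$2; Y$j; Y$4]
      - jet D (hat Y [:: i; j]) (nablaT D Rm 2)
          [tuple Y$1; Y$3; Y$i; Y$2; Y$j; Y$4]) p) X =
  young4e (jet_pair x y) + young4e (jet_pair y x) -
  young4e (fun a b c d => jet2_at (without Z [:: x; y]) a c x b y d +
                          jet2_at (without Z [:: x; y]) c a x b y d).
Proof.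
rewrite !mem_iota => i5 j5 ij.
have ik' : (0 < i <= k.+4)%N by lia.
have jk' : (0 < j <= k.+4)%N by lia.
have xZ : x \in Z by rewrite map_f // mem_iota.
have yZ : y \in Z by rewrite map_f // mem_iota.
rewrite (young_13 (F := fun a b c d =>
  jet_pair x y a b c d - jet2_at (without Z [:: x; y]) a c x b y d)).
  have W_C : without Z [:: y; x] = without Z [:: x; y].
    by apply: eq_filter => z; rewrite !inE orbC.
  (* Pair symmetry leaves an exchange of [b] and [d], which the second row absorbs, and the jet is
     symmetric in [a] and [c]. Hence the two terms of the row [[1,3]] account for both orders of the
     pair. *)
  have pair_yx a b c d : jet_pair y x a b c d = jet_pair x y a d c b.
    by rewrite /jet_pair W_C (curvature_pair _ _ _ _ (jet_curvature _)).
  have pair_ca a b c d : jet_pair x y c b a d = jet_pair x y a b c d.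
    by apply/eq_jet_at/permPl/(perm_catCA [:: c] [:: a]).
  rewrite [young4e (jet_pair y x)](eq_young4 _ _ _ _ pair_yx)
    (young4_swap _ _ _ _ (jet_pair x y)).
  rewrite -young4D -young4B; apply: eq_young4 => a b c d; rewrite /= pair_ca; ring.
move=> s sfix; rewrite /pact smoothfun_addE smoothfun_oppE.
have sW : map s (without Z [:: x; y]) = without Z [:: x; y].
  by apply: map_id_in => z; rewrite mem_filter => /andP[_ /sfix].
have u13 : uniq ([:: e 1; e 3] ++ without Z [:: x; y]).
  rewrite /= inE pos_eq // !mem_filter !negb_and !negbK filter_uniq ?tail_uniq //.
  rewrite (contraL (@tail_notin _)) ?inE ?eqxx ?orbT //.
  by rewrite (contraL (@tail_notin _)) ?inE ?eqxx ?orbT.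
rewrite !hatE; last by rewrite /= ik' jk'.
rewrite -[map e [:: i; j]]/[:: x; y] sW /arg !tnth_mktuple (sfix _ xZ) (sfix _ yZ).
rewrite jet2E_at ?filter_uniq ?tail_uniq //; congr (_ - _).
rewrite -[[:: _; _] ++ map _ _]/(map (tnth X)
  [:: s (e 1), s (e 3) & without Z [:: x; y]]).
rewrite jetE_at //.
by rewrite -sW -[[:: _, _ & _]]/(map s ([:: e 1; e 3] ++ without Z [:: x; y]))
  map_inj_uniq //; exact: perm_inj.
Qed.

Lemma alt_ricci i j (x := e i) (y := e j) :
  i \in iota 5 k -> j \in iota 5 k ->
  (2 * alt 1 2 (fun Y : k.+4.-tuple V =>
      jet D (hat Y [:: i; j]) (curv_act D Rm)
        [tuple Y$1; Y$i; Y$j; Y$2; Y$3; Y$4]) X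
    - alt 1 2 (alt 3 4 (fun Y : k.+4.-tuple V =>
      jet D (hat Y [:: i; j]) (curv_act D Rm)
        [tuple Y$1; Y$3; Y$i; Y$2; Y$j; Y$4])) X) p =
  alternated_ricci (jet2_at (without Z [:: x; y])) (e 1) (e 2) (e 3) (e 4) x y.
Proof.
rewrite !mem_iota => i5 j5.
have ijk : all (fun i => 0 < i <= k.+4)%N [:: i; j] by rewrite /=; lia.
have xy : {subset [:: x; y] <= Z}.
  by move=> z; rewrite !inE => /orP[]/eqP->; rewrite map_f // mem_iota.
have s_fix (s : {perm I}) : {in Z, forall z, s z = z} -> (s x = x) * (s y = y) *
    (map s (without Z [:: x; y]) = without Z [:: x; y]).
  move=> sZ; rewrite !sZ ?xy ?inE ?eqxx ?orbT //; split=> //.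
  by apply: map_id_in => z; rewrite mem_filter => /andP[_ /sZ].
have ricci12 (s : {perm I}) : {in Z, forall z, s z = z} ->
    pact s (fun Y : k.+4.-tuple V => jet D (hat Y [:: i; j]) (curv_act D Rm)
        [tuple Y$1; Y$i; Y$j; Y$2; Y$3; Y$4]) X p =
    let Q := jet2_at (without Z [:: x; y]) in
    Q (s (e 1)) x y (s (e 2)) (s (e 3)) (s (e 4)) -
    Q x (s (e 1)) y (s (e 2)) (s (e 3)) (s (e 4)).
  move=> sZ; rewrite /pact hatE // /arg !tnth_mktuple -[map e [:: i; j]]/[:: x; y].
  by rewrite !(s_fix _ sZ) jet_curv_actE_at // filter_uniq ?tail_uniq.
have ricci13 (s : {perm I}) : {in Z, forall z, s z = z} ->
    pact s (fun Y : k.+4.-tuple V => jet D (hat Y [:: i; j]) (curv_act D Rm)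
        [tuple Y$1; Y$3; Y$i; Y$2; Y$j; Y$4]) X p =
    let Q := jet2_at (without Z [:: x; y]) in
    Q (s (e 1)) (s (e 3)) x (s (e 2)) y (s (e 4)) -
    Q (s (e 3)) (s (e 1)) x (s (e 2)) y (s (e 4)).
  move=> sZ; rewrite /pact hatE // /arg !tnth_mktuple -[map e [:: i; j]]/[:: x; y].
  by rewrite !(s_fix _ sZ) jet_curv_actE_at // filter_uniq ?tail_uniq.
have fixZ (a b : I) : a \in [:: e 1; e 2; e 3; e 4] -> b \in [:: e 1; e 2; e 3; e 4] ->
    {in Z, forall z, tperm a b z = z}.
  move=> a4 b4 z /tail_notin z4; rewrite tpermD //;
  by apply: contraTneq z4 => <-; rewrite ?a4 ?b4.
have fix1 : {in Z, forall z, (1 : {perm I})%g z = z} by move=> z _; rewrite perm1.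
have fix12 : {in Z, forall z, tperm (e 1) (e 2) z = z}.
  by apply: fixZ; rewrite !inE eqxx ?orbT.
have fix34 : {in Z, forall z, tperm (e 3) (e 4) z = z}.
  by apply: fixZ; rewrite !inE eqxx ?orbT.
rewrite alt34_alt12 altE.
rewrite smoothfun_addE smoothfun_oppE smoothfun_mulE smoothfun_natE.
rewrite !(smoothfun_addE, smoothfun_oppE).
rewrite !ricci12 // !ricci13 //; last first.
  by move=> z zZ; rewrite permM fix34 ?fix12.
by rewrite /= !permM !perm1 !tperm_columns.
Qed.

(** * Comparison of coefficients *)

Definition rest x a b c d : R :=
  jet_without x a b x d c + jet_without x c b x d a +
  jet_without x x b c d a + jet_without x x b a d c.

(** The two row terms that leave the directions untouched give 12 by [young4_curvature]; [rest]
    collects those that put only [x] into a curvature slot. *)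
Lemma young4_full_row : young4e full_row =
  12 * jet_at Z (e 1) (e 2) (e 3) (e 4) +
  \sum_(x <- Z) young4e (rest x) +
  \sum_(x <- Z) \sum_(y <- Z | x != y) young4e (jet_pair x y).
Proof.
rewrite -(young4_curvature _ _ _ _ (jet_curvature Z)) -young4_sum -young4D.
under [X in _ = _ + X]eq_bigr => x _ do rewrite -young4_sum.
by rewrite -young4_sum -young4D.
Qed.

(** The two terms without exchange recur for every [x], hence [k] times in the total. *)
Lemma young4_mixed x : x \in Z -> young4e (mixed (jet_without x) x) =
  12 * jet_at Z (e 1) (e 2) (e 3) (e 4) + young4e (rest x).
Proof.
move=> xZ; rewrite -(young4_curvature _ _ _ _ (jet_curvature Z)) -young4D.
apply: eq_young4 => a b c d; rewrite /mixed.
have JZ a' b' c' d' : jet_without x a' b' c' d' x = jet_at Z a' b' c' d'.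
  have := jet_at_map (s := 1%g) (om := [:: x]) a' b' c' d'.
  rewrite /= perm1 (map_id_in (f := (1 : {perm I})%g)) => [->|z _] //;
    rewrite ?perm1 //.
  - by move=> z; rewrite inE => /eqP->.
  - by move=> z _; rewrite perm1.
by rewrite !JZ.
Qed.

Lemma sum_tail_neq (G : I -> I -> R) :
  \sum_(x <- Z) \sum_(y <- Z | x != y) G x y =
  \sum_(i <- iota 5 k) \sum_(j <- iota 5 k | i != j) G (e i) (e j).
Proof.
rewrite big_map; apply: eq_big_seq => i; rewrite mem_iota => ik.
rewrite big_map big_seq_cond [RHS]big_seq_cond; apply: eq_bigl => j; rewrite mem_iota.
by case: (boolP (4 < j < _)%N) => //= jk; rewrite pos_eq; lia.
Qed.

(** Once the [rest] and [jet_pair] terms match, only multiples of the jet remain: [12 - 2(k+2)(k+3)]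
    on the left and [12k - 24k - 2k(k-1)] on the right. *)
Lemma full_row_identity :
  young4e full_row - (2 * (k + 2) * (k + 3))%N%:R
    * jet_at Z (e 1) (e 2) (e 3) (e 4) =
  \sum_(i <- iota 5 k) (young4e (mixed (jet_without (e i)) (e i))
    - 24 * jet1_at (without Z [:: e i]) (e i) (e 1) (e 2) (e 3) (e 4)) +
  \sum_(i <- iota 5 k) \sum_(j <- iota 5 k | (i < j)%N)
    (young4e (jet_pair (e i) (e j)) + young4e (jet_pair (e j) (e i)) -
     young4e (fun a b c d =>
       jet2_at (without Z [:: e i; e j]) a c (e i) b (e j) d +
       jet2_at (without Z [:: e i; e j]) c a (e i) b (e j) d)) +
  \sum_(i <- iota 5 k) \sum_(j <- iota 5 k | i != j)
    alternated_ricci (jet2_at (without Z [:: e i; e j]))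
      (e 1) (e 2) (e 3) (e 4) (e i) (e j).
Proof.
set J := jet_at _ _ _ _ _.
have sZ : size Z = k by rewrite size_map size_iota.
(* The Ricci terms run over ordered pairs; both orders are joined to the term of the unordered pair,
   as [young4_nabla2] requires. *)
rewrite -[RHS]addrA [X in _ = _ + (_ + X)]sum_neq_lt -big_split /=.
pose J2 i j := jet2_at (without Z [:: e i; e j]) (e i) (e j) (e 1) (e 2) (e 3) (e 4).
have -> : \sum_(i <- iota 5 k) (\sum_(j <- iota 5 k | (i < j)%N)
    (young4e (jet_pair (e i) (e j)) + young4e (jet_pair (e j) (e i)) -
     young4e (fun a b c d =>
       jet2_at (without Z [:: e i; e j]) a c (e i) b (e j) d +
       jet2_at (without Z [:: e i; e j]) c a (e i) b (e j) d)) +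
   \sum_(j <- iota 5 k | (i < j)%N)
    (alternated_ricci (jet2_at (without Z [:: e i; e j]))
      (e 1) (e 2) (e 3) (e 4) (e i) (e j) +
     alternated_ricci (jet2_at (without Z [:: e j; e i]))
      (e 1) (e 2) (e 3) (e 4) (e j) (e i))) =
  \sum_(i <- iota 5 k) \sum_(j <- iota 5 k | i != j)
    (young4e (jet_pair (e i) (e j)) - 2 * J2 i j).
  rewrite sum_neq_lt; apply: eq_bigr => i _; rewrite -big_split /=.
  apply: eq_bigr => j _.
  have W_C : without Z [:: e j; e i] = without Z [:: e i; e j].
    by apply: eq_filter => z; rewrite !inE orbC.
  have := young4_nabla2 (e i) (e j) (e 1) (e 2) (e 3) (e 4)
    (jet2_curvature (without Z [:: e i; e j]))
    (jet2_bianchi (without Z [:: e i; e j])).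
  rewrite /J2 W_C => H; lra.
rewrite young4_full_row -/J sum_tail_neq.
have kJ : k%:R * J =
    \sum_(x <- Z) jet1_at (without Z [:: x]) x (e 1) (e 2) (e 3) (e 4).
  by rewrite -jet_rcons ?tail_uniq // sZ.
have kkJ : (k * k.-1)%N%:R * J = \sum_(x <- Z) \sum_(y <- Z | x != y)
    jet2_at (without Z [:: x; y]) x y (e 1) (e 2) (e 3) (e 4).
  by rewrite jet2_rcons ?tail_uniq // sZ.
have -> : \sum_(i <- iota 5 k) (young4e (mixed (jet_without (e i)) (e i)) -
      24 * jet1_at (without Z [:: e i]) (e i) (e 1) (e 2) (e 3) (e 4)) =
    \sum_(x <- Z) young4e (rest x) - 12 * (k%:R * J).
  rewrite -(big_map e xpredT (fun x => young4e (mixed (jet_without x) x) -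
    24 * jet1_at (without Z [:: x]) x (e 1) (e 2) (e 3) (e 4))).
  transitivity (\sum_(x <- Z) 12 * J + \sum_(x <- Z) young4e (rest x)
      - 24 * \sum_(x <- Z) jet1_at (without Z [:: x]) x (e 1) (e 2) (e 3) (e 4)).
    rewrite big_distrr -big_split -sumrB; apply: eq_big_seq => x xZ.
    by rewrite young4_mixed.
  rewrite -kJ big_const_seq count_predT sZ iter_addr_0 -mulr_natl; ring.
have -> : \sum_(i <- iota 5 k) \sum_(j <- iota 5 k | i != j)
      (young4e (jet_pair (e i) (e j)) - 2 * J2 i j) =
    \sum_(i <- iota 5 k) \sum_(j <- iota 5 k | i != j)
      young4e (jet_pair (e i) (e j)) - 2 * ((k * k.-1)%N%:R * J).
  rewrite kkJ sum_tail_neq big_distrr -sumrB; apply: eq_bigr => i _.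
  by rewrite big_distrr -sumrB.
(* At [k = 0] the truncated predecessor does no harm because of the factor [k]. *)
have -> : (k * k.-1)%N%:R = k%:R * (k%:R - 1) :> R.
  by case: (k) => [|m]; rewrite ?mul0r // natrM -natr1 addrK.
rewrite !natrM !natrD; ring.
Qed.

End Proposition.

(** The vector with index [A] in the sums carries the number [A.+4]. *)
Lemma sum_iota5 (V : nmodType) k (P : pred nat) (F : nat -> V) :
  \sum_(1 <= A < k.+1 | P A.+4) F A.+4 = \sum_(i <- iota 5 k | P i) F i.
Proof. by rewrite /index_iota subn1 (iotaDl 4 1) big_map. Qed.

Theorem proposition1 (R : realType) (n : nat) (M : manifold R n)
    (g : metric M) (D : vfield M -> vfield M -> vfield M)
    (hD : levi_civita g D) (p : M) (k : nat)
    (x : k.+4.-tuple (tangent p)) (X : k.+4.-tuple (vfield M))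
    (hX : forall i, tnth X i p = tnth x i) :
  let Rm := riemann D g in
  ((k`!%:R^-1 : R) *: young ([:: 1; 3]%N ++ iota 5 k) [:: 2; 4]%N
       (fun X => nabla D (hat X [::]) Rm [tuple X$1; X$2; X$3; X$4]) X
   - (2 * (k + 2) * (k + 3))%N%:R
     * jet D (hat X [::]) Rm [tuple X$1; X$2; X$3; X$4]) p
  =
  (\sum_(1 <= A < k.+1) young [:: 1; 3; A.+4]%N [:: 2; 4]%N
     (fun X =>
        jet D (hat X [::]) Rm [tuple X$1; X$2; X$3; X$4]
      - jet D (hat X [:: A.+4]) (nablaT D Rm 1)
          [tuple X$A.+4; X$1; X$2; X$3; X$4]) X
   + \sum_(1 <= A < k.+1) \sum_(1 <= B < k.+1 | (A < B)%N)
       young [:: 1; 3]%N [:: 2; 4]%N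
     (fun X =>
        jet D ([:: X$1; X$3] ++ hat X [:: A.+4; B.+4]) Rm
          [tuple X$A.+4; X$2; X$B.+4; X$4]
      - jet D (hat X [:: A.+4; B.+4]) (nablaT D Rm 2)
          [tuple X$1; X$3; X$A.+4; X$2; X$B.+4; X$4]) X
   + \sum_(1 <= A < k.+1) \sum_(1 <= B < k.+1 | A != B)
     (2 * alt 1 2 (fun X =>
        jet D (hat X [:: A.+4; B.+4]) (curv_act D Rm)
          [tuple X$1; X$A.+4; X$B.+4; X$2; X$3; X$4]) X
      - alt 1 2 (alt 3 4 (fun X =>
        jet D (hat X [:: A.+4; B.+4]) (curv_act D Rm)
          [tuple X$1; X$3; X$A.+4; X$2; X$B.+4; X$4])) X)) p.
Proof.
move=> Rm; rewrite !smoothfun_addE smoothfun_oppE smoothfun_scaleE.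
(* The factor [k!] from symmetrizing the directions cancels the normalization. *)
rewrite smoothfun_mulE smoothfun_natE young_at young_nabla young4Z mulKf; last first.
  by rewrite pnatr_eq0 -lt0n fact_gt0.
have -> : jet D (hat X [::]) Rm [tuple X$1; X$2; X$3; X$4] p =
    jet_at g D p X (map (@pos k.+3) (iota 5 k)) (pos 1) (pos 2) (pos 3) (pos 4).
  rewrite -[LHS](pact1 (fun Y => jet D (hat Y [::]) Rm _ p)).
  rewrite (pact_jet g D p X 1%g (om := [::]) 1 2 3 4) // !perm1.
  rewrite [without _ _]filter_predT map_id_in // => z _; exact: perm1.
rewrite (full_row_identity hD); congr (_ + _ + _).
- rewrite smoothfun_sumE -(sum_iota5 k predT); apply: eq_big_nat => A Ak.
  by rewrite young_at young_jet_mixed // mem_iota; lia.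
- rewrite smoothfun_sumE -(sum_iota5 k predT); apply: eq_big_nat => A Ak.
  rewrite smoothfun_sumE -(sum_iota5 k (fun j => A.+4 < j)%N).
  rewrite big_nat_cond [RHS]big_nat_cond; apply: eq_bigr => B /andP[Bk AB].
  by rewrite young_at young_jet_pair // mem_iota; lia.
rewrite smoothfun_sumE -(sum_iota5 k predT); apply: eq_big_nat => A Ak.
rewrite smoothfun_sumE -(sum_iota5 k (fun j => A.+4 != j)%N).
rewrite big_nat_cond [RHS]big_nat_cond; apply: eq_bigr => B /andP[Bk AB].
by rewrite alt_ricci // mem_iota; lia.
Qed.
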